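(* For all $\upsilon,\tau\in\mathcal K^J$, $$\sum_{\kappa\in\mathcal K^J}(-1)^{\mathrm{ht}(\upsilon)+\mathrm{ht}(\kappa)}\,\mathbf m^\sigma_{\upsilon\kappa}\,\mathbf n^{\sigma^\vee}_{\tau^\vee\kappa^\vee}=\delta_{\upsilon\tau}.$$
   Context: Let $(W,S)$ be a finite Coxeter system with length $\ell$, Bruhat order $\le$, reflections $T=\{wsw^{-1}\}$. $\mathrm{Aut}(W,S)$: automorphisms preserving $S$; $W^+=W\rtimes\mathrm{Aut}(W,S)$, $(v,\alpha)(w,\beta)=(v\,\alpha(w),\alpha\beta)$, $\ell(w,\varphi)=\ell(w)$, $w\equiv(w,1)$. Perfect involution: $z\in W^+$ with $z^2=1$, $(zt)^4=1$ for all $t\in T$. For $K\subseteq S$: $W_K=\langle K\rangle$; $\mathscr I_K$ = perfect involutions of $W_K\rtimes\mathrm{Aut}(W_K,K)$, with $W_K$ acting by $v:(y,\theta)\mapsto(vy\theta(v)^{-1},\theta)$; $W_K$-minimal: $\ell(szs)\ge\ell(z)$ for $s\in K$ (unique per class). $W^K=\{w:\ell(ws)>\ell(w)\ \forall s\in K\}$, $\mathcal K^K=W^K\times\mathscr I_K$, $\mathrm{ht}(w,z)=\ell(w)+\tfrac12(\ell(z)-\ell(z_{\min}))$. $W$ acts on $\mathcal K^K$ by $s(w,z)=(sw,z)$ if $sw\in W^K$, else $(w,tzt)$, $t=w^{-1}sw\in K$. Quasiparabolic Bruhat order on $\mathscr I_K$: transitive closure of $z<tzt$ ($t$ a reflection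 of $W_K$, $\ell(z)<\ell(tzt)$). $\prec$ on $\mathcal K^K$: $(w,z)\prec(w',z')$ iff same $W$-orbit, smaller $\mathrm{ht}$, and ($w<w'$ in Bruhat order, or $w=w'$ and $z<z'$). For a homomorphism $\rho:W_K\to\{\pm1\}$ and $\tau=(w,z)$: $\mathrm{Asc}^<(\tau;\rho)=\{s:\mathrm{ht}(s\tau)>\mathrm{ht}(\tau)\}$, $\mathrm{Des}^<(\tau;\rho)=\{s:\mathrm{ht}(s\tau)<\mathrm{ht}(\tau)\}$, $\mathrm{Asc}^=(\tau;\rho)=\{s:\mathrm{ht}(s\tau)=\mathrm{ht}(\tau),\rho(w^{-1}sw)=-1\}$, $\mathrm{Des}^=(\tau;\rho)=\{s:\mathrm{ht}(s\tau)=\mathrm{ht}(\tau),\rho(w^{-1}sw)=1\}$. $\mathcal H$: Iwahori–Hecke algebra over $\mathbb Z[x,x^{-1}]$, basis $H_w$, $H_sH_w=H_{sw}$ if $\ell(sw)>\ell(w)$, else $H_{sw}+(x-x^{-1})H_w$; bar operator: antilinear ($x\mapsto x^{-1}$) ring involution with $\overline{H_w}=(H_{w^{-1}})^{-1}$. $\mathcal M^\rho$ is the free module with basis $M^\rho_\tau$ ($\tau\in\mathcal K^K$) with $H_sM^\rho_\tau=M^\rho_{s\tau}$, $M^\rho_{s\tau}+(x-x^{-1})M^\rho_\tau$, $-x^{-1}M^\rho_\tau$, $xM^\rho_\tau$ according as $s\in\mathrm{Asc}^<,\mathrm{Des}^<,\mathrm{Asc}^=,\mathrm{Des}^=$ of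 $(\tau;\rho)$, with the unique antilinear $\overline{\cdot}$ satisfying $\overline{HM}=\overline H\,\overline M$ and fixing $M^\rho_\tau$ whenever $\mathrm{Des}^<(\tau;\rho)=\varnothing$, and unique basis $\underline M^\rho_\tau$ with $\overline{\underline M^\rho_\tau}=\underline M^\rho_\tau\in M^\rho_\tau+\sum_{\upsilon\prec\tau}x^{-1}\mathbb Z[x^{-1}]M^\rho_\upsilon$. Write $\underline M^\rho_\tau=\sum_\upsilon\mathbf m^\rho_{\upsilon\tau}M^\rho_\upsilon$ and set $\mathbf n^\rho_{\upsilon\tau}:=\mathbf m^{\mathrm{sgn}\cdot\rho}_{\upsilon\tau}$, where $\mathrm{sgn}(w)=(-1)^{\ell(w)}$. Fix $J\subseteq S$ and $\sigma:W_J\to\{\pm1\}$. Let $w_0,w_J$ be the longest elements of $W,W_J$, $\mathrm{Ad}(v):w\mapsto vwv^{-1}$, $J^\vee=w_0Jw_0$, $\sigma^\vee=\sigma\circ\mathrm{Ad}(w_0):W_{J^\vee}\to\{\pm1\}$. For $z=(y,\theta)\in\mathscr I_J$ let $z^\vee=(w_0w_Jyw_0,\ \mathrm{Ad}(w_0)\circ\mathrm{Ad}(w_J)\circ\theta\circ\mathrm{Ad}(w_0))$, and for $\tau=(w,z)\in\mathcal K^J$ let $\tau^\vee=(ww_Jw_0,z^\vee)\in\mathcal K^{J^\vee}$. $\delta$ is the Kronecker delta. *)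

(* Defs.v *)
From HB Require Import structures.
From mathcomp Require Import all_boot all_order all_algebra all_fingroup.
From mathcomp Require Import fraction.
Set Implicit Arguments. Unset Strict Implicit. Unset Printing Implicit Defensive.
Import GRing.Theory.

Local Open Scope group_scope.

(* Laurent polynomials Z[x,x^-1], realised inside the fraction field of     *)
(* Z[x]; the module M^rho is realised inside LF^{K^J}.                       *)
Definition LF : fieldType := {fraction {poly int}}.
Definition toLF (p : {poly int}) : LF := @FracField.tofrac _ p.
Definition X : LF := toLF 'X.

Definition pbar (p : {poly int}) : LF :=
  (\sum_(i < size p) (p`_i)%:~R / X ^+ i)%R.

(* f lies in x^{-1} Z[x^{-1}] *)
Definition laurent_neg (f : LF) : Prop :=
  exists (n : nat) (q : {poly int}), (size q <= n)%N /\ f = (toLF q / X ^+ n)%R.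

Section Coxeter.
Variable W : finGroupType.

(* (W,S) is a (finite) Coxeter system: S generates W, consists of          *)
(* involutions, and W has the presentation <S | (st)^{m(s,t)} = 1> where   *)
(* m(s,t) is the order of st (universal property of the presentation).      *)
Definition coxeter_system (S : {set W}) : Prop :=
  [/\ <<S>> = [set: W],
      {in S, forall s, s != 1 /\ s ^+ 2 = 1} &
      forall (G : finGroupType) (f : W -> G),
        {in S &, forall s t, (f s * f t) ^+ #[s * t] = 1} ->
        exists h : W -> G, {morph h : x y / x * y} /\ {in S, h =1 f}].

Variable S : {set W}.

Fixpoint words (n : nat) : {set W} :=
  if n is n'.+1 then [set s * x | s in S, x in words n'] else [set 1].

Definition len (w : W) : nat := find (fun n => w \in words n) (iota 0 #|W|).

Definition refl (K : {set W}) : {set W} := [set w * s * w^-1 | w in <<K>>, s in K].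

Definition bruhat_le (u v : W) : bool :=
  connect (fun a b => (a^-1 * b \in refl S) && (len a < len b)%N) u v.
Definition bruhat_lt (u v : W) : bool := bruhat_le u v && (u != v).

Definition longest (G : {set W}) : W := [arg max_(w > (1 : W) in G) len w].

(* Aut(W_K,K): automorphisms of W_K (as permutations of W supported on W_K) *)
Definition AutK (K : {set W}) : {set {perm W}} := [set a in Aut <<K>> | a @: K == K].

(* elements (y,theta) of W^+ = W x| Aut ; multiplication *)
Definition sdmul (a b : W * {perm W}) : W * {perm W} := (a.1 * a.2 b.1, b.2 * a.2).
Definition sd1 : W * {perm W} := (1, 1).

Definition perfect (K : {set W}) (z : W * {perm W}) : bool :=
  [&& z.1 \in <<K>>, z.2 \in AutK K, sdmul z z == sd1 &
      [forall t in refl K, let u := sdmul z (t, 1) in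
         sdmul (sdmul u u) (sdmul u u) == sd1]].
Definition IK (K : {set W}) : {set W * {perm W}} := [set z | perfect K z].

Definition zact (z : W * {perm W}) (v : W) : W * {perm W} :=
  (v * z.1 * (z.2 v)^-1, z.2).
Definition zorbit (K : {set W}) z : {set W * {perm W}} := [set zact z v | v in <<K>>].
Definition zminimal (K : {set W}) z : bool := [forall s in K, len z.1 <= len (zact z s).1].
(* the (unique) W_K-minimal element of the class of z *)
Definition zmin (K : {set W}) z : W * {perm W} :=
  odflt z [pick y in zorbit K z | zminimal K y].

Definition qb_lt (K : {set W}) (z z' : W * {perm W}) : bool :=
  connect (fun a b => [exists t in refl K, (b == zact a t) && (len a.1 < len b.1)%N]) z z'
  && (z != z').

Definition P := (W * (W * {perm W}))%type.

Definition WKmin (K : {set W}) : {set W} := [set w | [forall s in K, len w < len (w * s)]].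
Definition KK (K : {set W}) : {set P} := [set k : P | (k.1 \in WKmin K) && (k.2 \in IK K)].

Definition ht (K : {set W}) (k : P) : nat :=
  len k.1 + (len k.2.1 - len (zmin K k.2).1)./2.

Definition sact (K : {set W}) (s : W) (k : P) : P :=
  if s * k.1 \in WKmin K then (s * k.1, k.2) else (k.1, zact k.2 (k.1^-1 * s * k.1)).

Definition same_orbit (K : {set W}) (a b : P) : bool :=
  connect (fun x y => [exists s in S, y == sact K s x]) a b.

Definition prec (K : {set W}) (a b : P) : bool :=
  [&& same_orbit K a b, (ht K a < ht K b)%N &
      bruhat_lt a.1 b.1 || ((a.1 == b.1) && qb_lt K a.2 b.2)].

Definition KT (K : {set W}) := {k : P | k \in KK K}.

Local Open Scope ring_scope.

Definition delta (K : {set W}) (t : KT K) : {ffun KT K -> LF} := [ffun u => (u == t)%:R].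

Definition Ts_basis (K : {set W}) (rho : W -> int) (s : W) (t : KT K) : {ffun KT K -> LF} :=
  let st := sact K s (val t) in
  let h := ht K (val t) in
  let h' := ht K st in
  [ffun u =>
     if (h < h')%N then ((val u == st)%:R : LF)
     else if (h' < h)%N then (val u == st)%:R + (X - X^-1) * (u == t)%:R
     else if rho (((val t).1)^-1 * s * (val t).1)%g == -1 then - X^-1 * (u == t)%:R
     else X * (u == t)%:R].

Definition Ts (K : {set W}) (rho : W -> int) (s : W) (f : {ffun KT K -> LF}) : {ffun KT K -> LF} :=
  [ffun u => \sum_(t : KT K) f t * Ts_basis rho s t u].

Definition scl (K : {set W}) (c : LF) (f : {ffun KT K -> LF}) : {ffun KT K -> LF} :=
  [ffun u => c * f u].

Definition bar_spec (K : {set W}) (rho : W -> int)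
  (bar : {ffun KT K -> LF} -> {ffun KT K -> LF}) : Prop :=
  [/\ forall f g, bar (f + g) = bar f + bar g,
      forall (n : nat) (p : {poly int}) f,
        bar (scl (toLF p / X ^+ n) f) = scl (pbar p * X ^+ n) (bar f),
      (* bar(H_s M) = (H_s)^{-1} bar(M) *)
      forall s, s \in S -> forall f, Ts rho s (bar (Ts rho s f)) = bar f &
      forall t : KT K, (forall s, s \in S -> ~~ (ht K (sact K s (val t)) < ht K (val t))%N) ->
        bar (delta t) = delta t].

(* m : the coefficients of the canonical basis: underline M_t = sum_u m u t M_u *)
Definition canon_spec (K : {set W}) (rho : W -> int) (m : P -> P -> LF) : Prop :=
  exists bar, bar_spec rho bar /\
  forall t : KT K,
    bar [ffun u : KT K => m (val u) (val t)] = [ffun u : KT K => m (val u) (val t)] /\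
    m (val t) (val t) = 1 /\
    forall u : KT K, u != t ->
      if prec K (val u) (val t) then laurent_neg (m (val u) (val t))
      else m (val u) (val t) = 0.

Definition sign_hom (K : {set W}) (rho : W -> int) : Prop :=
  {in <<K>> &, forall x y, rho (x * y)%g = rho x * rho y} /\
  {in <<K>>, forall x, rho x = 1 \/ rho x = -1}.

Local Close Scope ring_scope.

Definition w0 : W := longest [set: W].
Definition Ad (v : W) : {perm W} := actperm 'J v^-1.
Definition dualJ (J : {set W}) : {set W} := [set w0 * s * w0 | s in J].
Definition dual_sigma (sigma : W -> int) : W -> int := fun x => sigma (w0 * x * w0^-1).
Definition sgn_times (rho : W -> int) : W -> int := fun x => ((-1) ^+ len x * rho x)%R.
Definition dualz (J : {set W}) (z : W * {perm W}) : W * {perm W} :=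
  let wJ := longest <<J>> in
  (w0 * wJ * z.1 * w0,
   restr_perm <<dualJ J>> (Ad w0 * z.2 * Ad wJ * Ad w0)).
Definition dualk (J : {set W}) (k : P) : P :=
  (k.1 * longest <<J>> * w0, dualz J k.2).

End Coxeter.

(* Main.v *)
Require Import Defs.
From HB Require Import structures.
From mathcomp Require Import all_boot all_order all_algebra all_fingroup.
From mathcomp Require Import fraction.
From mathcomp Require Import zify ring.
Set Implicit Arguments. Unset Strict Implicit. Unset Printing Implicit Defensive.
Import GRing.Theory.

(** Pair the module with basis [M_t] with its dual counterpart with basis
    [N_(u^v)] by [<M_t, N_(u^v)> = (-1)^(ht t)] if [t = u] and [0] otherwise.
    Duality reverses ascents and descents and exchanges the two eigenvalues, so
    that [<H_s M, N> = - <M, H_s^-1 N>].  It follows that the pairing is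
    compatible with the bar operators, by induction on the height of [u^v]: when
    [u^v] is a local minimum it has height 0, hence [u] has maximal height in its
    orbit ([ht u + ht u^v] is constant on orbits) and only [bar M_u] can involve
    [M_u].  The pairing of two canonical basis elements is then bar invariant, and
    off the diagonal it lies in [x^-1 Z[x^-1]], so it vanishes there.

    A twisted involution that is minimal under conjugation by simple reflections
    has length equal to the number of positive roots that it negates.  As this
    number is a class invariant bounded by the length, local minima are global. *)

(* Rewriting leaves convertible but syntactically distinct copies of the group
   operations inside [len]; they are identified before calling [lia]. *)
Ltac lenlia :=
  repeat match goal with
    H : ?T |- _ => match T with context [@len _ _ _] => revert H end end;
  repeat match goal with
    |- context [@len ?W ?S ?a] => match goal with
      |- context [@len W S ?b] =>
        assert_fails (constr_eq a b); change (@len W S b) with (@len W S a) end end;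
  lia.

(** * Words and lengths *)

Section Words.
Local Open Scope group_scope.
Variables (W : finGroupType) (S : {set W}).
Implicit Types (u v : seq W) (w s t : W).

Definition wprod u : W := foldr mulg 1 u.

Lemma wprod_cat u v : wprod (u ++ v) = wprod u * wprod v.
Proof. by elim: u => [|s u IH] /=; rewrite ?mul1g // IH mulgA. Qed.

Lemma wordsP n w :
  reflect (exists u, [/\ all (mem S) u, size u = n & wprod u = w]) (w \in words S n).
Proof.
apply: (iffP idP); elim: n w => [|n IH] w /=.
- by rewrite inE => /eqP ->; exists [::].
- case/imset2P => s x sS /IH [u [uS <- <-]] ->.
  by exists (s :: u); rewrite /= sS.
- by case=> [[|s u]] [] //= _ _ <-; rewrite inE.
- case=> [[|s u]] [] //= /andP[sS uS] [su] <-.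
  by apply/imset2P; exists s (wprod u) => //; apply: IH; exists u.
Qed.

(** The search in [len] stops at [#|W|]; this shows that it cannot run out. The prefix products of a
    shortest word are pairwise distinct, so there are at most [#|W|] of them. *)
Lemma words_shorten n w : w \in words S n ->
  exists k, [/\ (k <= n)%N, (k < #|W|)%N & w \in words S k].
Proof.
move=> wn; have ex : exists k, w \in words S k by exists n.
case: (ex_minnP ex) => k /wordsP[u [uS su uw]] kmin.
exists k; split; first exact: kmin; last by apply/wordsP; exists u.
pose f (i : 'I_k.+1) := wprod (take i u).
suff /leq_card : injective f by rewrite card_ord.
(* Two equal prefix products would allow the letters between them to be cut out. *)
have key (i j : 'I_k.+1) : (i < j)%N -> f i = f j -> False.
  move=> ij eqf; have : w \in words S (i + (k - j)).
    apply/wordsP; exists (take i u ++ drop j u); split.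
    - rewrite all_cat; have := uS; rewrite -{1}(cat_take_drop i u) all_cat => /andP[-> _].
      by have := uS; rewrite -{1}(cat_take_drop j u) all_cat => /andP[_ ->].
    - by rewrite size_cat size_drop size_takel su // -ltnS.
    - by rewrite wprod_cat -/(f i) eqf -wprod_cat cat_take_drop.
  by move/kmin; have := ltn_ord j; lia.
move=> i j eqf; apply/val_inj/eqP; rewrite /= eqn_leq.
by apply/andP; split; rewrite leqNgt; apply/negP => /key; apply.
Qed.

Lemma len_wprod u : all (mem S) u -> (len S (wprod u) <= size u)%N.
Proof.
move=> uS; have : wprod u \in words S (size u) by apply/wordsP; exists u.
case/words_shorten => k [ku kW wk]; apply: leq_trans ku.
rewrite /len leqNgt; apply/negP => /(before_find 0).
by rewrite nth_iota // add0n wk.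
Qed.

Lemma reduced_word w : {in S, forall s, s ^+ 2 = 1} -> w \in <<S>> ->
  exists u, [/\ all (mem S) u, wprod u = w & size u = len S w].
Proof.
move=> S2 /gen_prodgP[n [c cS ->]].
set w' := \prod_(i < n) c i.
have [u0 u0S u0w] : exists2 u, all (mem S) u & wprod u = w'.
  apply: (big_rec (fun x => exists2 u, all (mem S) u & wprod u = x)).
    by exists [::].
  by move=> i x _ [u uS <-]; exists (c i :: u); rewrite //= cS.
have : w' \in words S (size u0) by apply/wordsP; exists u0.
case/words_shorten => k [_ kW wk].
have hs : has (fun n => w' \in words S n) (iota 0 #|W|).
  by apply/hasP; exists k => //; rewrite mem_iota.
have := nth_find 0 hs; rewrite -/(len S w') nth_iota ?add0n; last first.
  by rewrite -[X in (_ < X)%N](size_iota 0) -has_find.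
by case/wordsP=> u [uS su uw]; exists u.
Qed.

End Words.

(** * The inversion cocycle *)

Section Cocycle.
Local Open Scope group_scope.
Variables (W : finGroupType) (S : {set W}).
Hypothesis coxS : coxeter_system S.
Implicit Types (s t v w : W).

Lemma simple_sqr s : s \in S -> s * s = 1.
Proof. by case: coxS => _ h _ /h [] _; rewrite expgS expg1. Qed.

Lemma simple_inv s : s \in S -> s^-1 = s.
Proof. by move/simple_sqr => h; apply/eqP; rewrite eq_invg_mul h. Qed.

(** The action of a simple reflection on signed reflections, that is on roots: only the root of [s]
    changes sign. It is defined on all of [W], which keeps it a permutation of a plain product
    type. *)
Definition signed_conj_fun s (x : W * bool) : W * bool := (x.1 ^ s, x.2 (+) (x.1 == s)).

Lemma signed_conj_inj s : injective (signed_conj_fun s).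
Proof. by move=> [t a] [t' b] [/conjg_inj -> /addIb ->]. Qed.

Definition signed_conj s : {perm W * bool} := perm (@signed_conj_inj s).

(** Along the word [stst...] of length [2k], with [k] the order of [p = st], the sign of [r] flips
    at letter [j] exactly when [r = p^j s]. Since [p^k = 1], each flip in the first half recurs in
    the second, and the signs cancel. *)
Lemma signed_conj_dihedral :
  {in S &, forall s t, (signed_conj s * signed_conj t) ^+ #[s * t] = 1}.
Proof.
move=> s t sS tS; set p := s * t; apply/permP => -[r a]; rewrite perm1.
have pV : s * p = p^-1 * s by
  rewrite /p invMg !simple_inv // -mulgA simple_sqr // mulg1 mulgA simple_sqr // mul1g.
have sp k : s * p ^+ k = p ^- k * s.
  elim: k => [|k IH]; first by rewrite expg0 invg1 mulg1 mul1g.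
  by rewrite expgSr mulgA IH -mulgA pV mulgA -invMg -expgS expgSr.
have ps k : s * p ^- k = p ^+ k * s.
  by apply: (mulgI (p ^- k)); rewrite mulKg mulgA -sp mulgK.
pose g j := r == p ^+ j * s.
have iterE k : ((signed_conj s * signed_conj t) ^+ k) (r, a)
    = (r ^ (p ^+ k), a (+) \big[addb/false]_(j < k.*2) g j).
  elim: k => [|k IH]; first by rewrite !expg0 perm1 conjg1 big_ord0 addbF.
  rewrite expgSr permM IH permM !permE /signed_conj_fun /= -!conjgM -/p -expgSr.
  rewrite doubleS !big_ord_recr /= !addbA; congr (_, _ (+) _ (+) _); rewrite /g.
    rewrite (can2_eq (conjgK _) (conjgKV _)) conjgE invgK -addnn expgD.
    by rewrite -mulgA ps mulgA.
  rewrite (can2_eq (conjgK _) (conjgKV _)) conjgE invgK invMg simple_inv //.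
  by rewrite ps !mulgA -(mulgA _ s t) -/p -expgSr -expgD -addnn addSn.
rewrite iterE expg_order conjg1; congr (_, _).
rewrite -addnn big_split_ord /=.
under [X in _ (+) (_ (+) X)]eq_bigr => j _ do rewrite /g expgD expg_order mul1g.
by rewrite addbb addbF.
Qed.

(** The presentation extends [signed_conj] to a homomorphism into permutations; [N w t] is the sign
    that [w] puts on [t]. Permutations compose from left to right, hence the right action [t ^ v] in
    the cocycle rule. *)
Lemma inversion_cocycle : exists N : W -> W -> bool,
  [/\ forall t, N 1 t = false,
      {in S, forall s t, N s t = (t == s)} &
      forall v w t, N (v * w) t = N v t (+) N w (t ^ v)].
Proof.
case: (coxS) => genS _ /(_ _ _ signed_conj_dihedral) [h [hM hS]].
have h1 : h 1 = 1 by apply: (mulgI (h 1)); rewrite -hM !mulg1.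
have hE w t a : h w (t, a) = (t ^ w, a (+) (h w (t, false)).2).
  have : w \in <<S>> by rewrite genS inE.
  case/reduced_word => [|u [uS <- _]].
    by move=> s sS; rewrite expgS expg1 simple_sqr.
  elim: u uS t a => [|s u IH] /= uS t a; first by rewrite h1 !perm1 conjg1 addbF.
  have /andP[sS /IH {}IH] := uS.
  rewrite hM !permM (hS s sS) !permE /signed_conj_fun /=.
  by rewrite IH [in RHS]IH /= conjgM addbA.
exists (fun w t => (h w (t, false)).2); split => [t|s sS t|v w t].
- by rewrite h1 perm1.
- by rewrite (hS s sS) permE.
- by rewrite hM permM hE hE.
Qed.

Definition inv w t : bool := (t \in refl S) && (len S (t * w) < len S w)%N.

Lemma mem_genS w : w \in <<S>>.
Proof. by case: coxS => -> _ _; rewrite inE. Qed.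

Lemma len_word w : exists u, [/\ all (mem S) u, wprod u = w & size u = len S w].
Proof. by apply: reduced_word (mem_genS w) => s sS; rewrite expgS expg1 simple_sqr. Qed.

Lemma mem_refl v s : s \in S -> v * s * v^-1 \in refl S.
Proof. by move=> sS; apply/imset2P; exists v s; rewrite ?mem_genS. Qed.

Lemma simple_refl s : s \in S -> s \in refl S.
Proof. by move/(mem_refl 1); rewrite mul1g invg1 mulg1. Qed.

Lemma refl_conj t v : t \in refl S -> t ^ v \in refl S.
Proof.
case/imset2P => x s _ sS ->; rewrite conjgE !mulgA.
by have := mem_refl (v^-1 * x) sS; rewrite invMg invgK !mulgA.
Qed.

Lemma refl_sqr t : t \in refl S -> t * t = 1.
Proof.
by case/imset2P => x s _ sS ->; rewrite !mulgA mulgKV -(mulgA x) simple_sqr // mulg1 mulgV.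
Qed.

(** The length-theoretic inversions are identified with the cocycle [N]. If [N w t] holds, some
    letter of a word for [w] flips [t], and deleting it yields [t * w]. Deletion keeps the letters
    inside any predicate [K], which later serves parabolic subgroups. *)
Lemma inv_spec :
  [/\ forall t, inv 1 t = false,
      {in S, forall s t, inv s t = (t == s)},
      forall v w t, inv (v * w) t = inv v t (+) inv w (t ^ v) &
      forall (K : {pred W}) u t, all K u -> all (mem S) u -> inv (wprod u) t ->
        exists u', [/\ all K u', size u = (size u').+1 & t * wprod u = wprod u']].
Proof.
case: inversion_cocycle => N [N1 NS NM].
have exch (K : {pred W}) u t : all K u -> all (mem S) u -> N (wprod u) t ->
    [/\ t \in refl S & exists u', [/\ all K u', size u = (size u').+1 & t * wprod u = wprod u']].
  elim: u t => [|s u IH] t /=; first by rewrite N1.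
  case/andP=> sK uK /andP[sS uS]; rewrite NM (NS s sS).
  case: eqP => [-> _|_ /= Nt].
    by split; [exact: simple_refl | exists u; rewrite mulgA simple_sqr // mul1g].
  have [tS [u' [u'K su' u'E]]] := IH _ uK uS Nt; split.
    by have := refl_conj s^-1 tS; rewrite conjgK.
  by exists (s :: u'); rewrite /= sK u'K su' -u'E conjgE !mulgA mulgV mul1g.
have Nlt w t : N w t -> inv w t.
  case: (len_word w) => u [uS uw su]; rewrite -{1}uw => /(exch _ _ _ uS uS).
  case=> tS [u' [u'S su' u'E]]; rewrite /inv tS -uw u'E uw -su su' ltnS.
  exact: len_wprod.
(* For [t = x s x^-1] the contributions of [x] and [x^-1] cancel, because they add up to [N 1 t];
   the middle letter contributes one flip. *)
have Ntt t : t \in refl S -> N t t.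
  case/imset2P => x s _ sS ->.
  have := NM x x^-1 (x * s * x^-1); rewrite mulgV N1.
  have -> : (x * s * x^-1) ^ x = s by rewrite conjgE !mulgA mulVg mul1g mulgKV.
  move=> e; rewrite !NM (NS s sS) conjgM.
  have -> : (x * s * x^-1) ^ x = s by rewrite conjgE !mulgA mulVg mul1g mulgKV.
  rewrite (conjgE s s) mulKg eqxx.
  by move/esym: e; case: (N x _); case: (N x^-1 _).
have invN w t : inv w t = N w t.
  apply/idP/idP => [/andP[tS tw]|/Nlt //].
  (* If [N w t] fails then [N (t * w) t] holds, so [t] shortens [t * w] to [w], against [t * w]
     being shorter. *)
  apply/negPn/negP => nN; have : inv (t * w) t.
    by apply: Nlt; rewrite NM Ntt // conjgE mulKg (negbTE nN).
  by case/andP => _; rewrite mulgA refl_sqr // mul1g ltnNge ltnW.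
split=> [t|s sS t|v w t|K u t uK uS].
- by rewrite invN N1.
- by rewrite invN (NS s sS).
- by rewrite !invN NM.
- by rewrite invN => /(exch _ _ _ uK uS) [].
Qed.

Lemma inv1 t : inv 1 t = false.
Proof. by case: inv_spec. Qed.

Lemma inv_simple s t : s \in S -> inv s t = (t == s).
Proof. by case: inv_spec => _ h _ _ /h. Qed.

Lemma invM v w t : inv (v * w) t = inv v t (+) inv w (t ^ v).
Proof. by case: inv_spec. Qed.

Lemma exchange (K : {pred W}) u t : all K u -> all (mem S) u -> inv (wprod u) t ->
  exists u', [/\ all K u', size u = (size u').+1 & t * wprod u = wprod u'].
Proof. by case: inv_spec => _ _ _ h; apply: h. Qed.

End Cocycle.

(** * Parabolic subgroups and longest elements *)

Section Length.
Local Open Scope group_scope.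
Variables (W : finGroupType) (S : {set W}).
Hypothesis coxS : coxeter_system S.
Implicit Types (s t v w : W) (K : {set W}).

Lemma len1 : len S 1 = 0%N.
Proof. by apply/eqP; rewrite -leqn0; apply: (@len_wprod _ S [::]). Qed.

Lemma len_eq0 w : len S w = 0%N -> w = 1.
Proof. by case: (len_word coxS w) => u [_ <- <-] /size0nil ->. Qed.

Lemma lenM v w : (len S (v * w) <= len S v + len S w)%N.
Proof.
case: (len_word coxS v) => u [uS <- <-]; case: (len_word coxS w) => u' [uS' <- <-].
by rewrite -wprod_cat -size_cat len_wprod // all_cat uS.
Qed.

Lemma lenV w : len S w^-1 = len S w.
Proof.
have le v : (len S v^-1 <= len S v)%N.
  case: (len_word coxS v) => u [uS <- <-].
  have -> : (wprod u)^-1 = wprod (rev u).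
    elim: u uS => [|s u IH] /=; first by rewrite invg1.
    case/andP=> sS /IH; rewrite invMg rev_cons -cats1 wprod_cat => ->.
    by rewrite /= mulg1 (simple_inv coxS).
  by rewrite -(size_rev u) len_wprod // all_rev.
by apply/eqP; rewrite eqn_leq le -{1}(invgK w) le.
Qed.

Lemma inv_len s w : s \in S -> inv S w s = (len S (s * w) < len S w)%N.
Proof. by move=> sS; rewrite /inv (simple_refl coxS). Qed.

Lemma len_simple s : s \in S -> len S s = 1%N.
Proof.
move=> sS; have : inv S s s by rewrite (inv_simple coxS).
rewrite inv_len // (simple_sqr coxS) // len1 => h; apply/eqP.
by rewrite eqn_leq h -{1}(mulg1 s) (@len_wprod _ S [:: s]) //= sS.
Qed.

Lemma len_simpleM s w : s \in S ->
  if inv S w s then len S w = (len S (s * w)).+1 else len S (s * w) = (len S w).+1.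
Proof.
move=> sS; have h1 := lenM s w; have h2 := lenM s (s * w).
have := invM coxS s w s; rewrite (inv_simple coxS s sS) eqxx conjgE mulKg.
rewrite !inv_len //; rewrite mulgA (simple_sqr coxS) // mul1g in h2 *.
by rewrite (len_simple sS) in h1 h2; case: (ltnP _ (len S w)) => /=; lenlia.
Qed.

Lemma len_simpleMN s w : s \in S -> (len S (s * w) < len S w)%N = ~~ (len S w < len S (s * w))%N.
Proof. by move=> sS; have := len_simpleM w sS; rewrite inv_len //; case: ltnP; lenlia. Qed.

Lemma len_simpleM_or s w : s \in S ->
  len S (s * w) = (len S w).+1 \/ len S w = (len S (s * w)).+1.
Proof. by move=> sS; have := len_simpleM w sS; case: ifP => _ ->; [right|left]. Qed.

Lemma len_Msimple s w : s \in S ->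
  len S (w * s) = (len S w).+1 \/ len S w = (len S (w * s)).+1.
Proof.
move=> sS; have := len_simpleM w^-1 sS.
rewrite lenV -(lenV (w * s)) invMg (simple_inv coxS sS).
by case: (inv _ _ _) => ->; [right|left].
Qed.

(** [s] is an inversion of [w * t] but not of [w], so the cocycle rule leaves only [s ^ w = t]. *)
Lemma lifting s t w : s \in S -> t \in S -> (len S w < len S (s * w))%N ->
  (len S w < len S (w * t))%N -> (len S (s * w * t) < len S (w * t))%N -> s * w = w * t.
Proof.
move=> sS tS h1 h2; rewrite -mulgA -inv_len // (invM coxS) inv_len // ltnNge ltnW //=.
rewrite (inv_simple coxS _ tS) => /eqP <-.
by rewrite conjgE mulKVg.
Qed.

(** Whenever a word in [K] fails to be reduced, exchange deletes one of its letters without leaving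
    [K]. Hence [W_K] has the same length function inside [W] as on its own. *)
Lemma par_word K w : K \subset S -> w \in <<K>> ->
  exists u, [/\ all (mem K) u, wprod u = w & size u = len S w].
Proof.
move=> KS /reduced_word[|u [uK <- _]].
  by move=> s /(subsetP KS) sS; rewrite expgS expg1 (simple_sqr coxS).
elim: u uK => [|s u IH] /=; first by exists [::]; rewrite len1.
case/andP=> sK /IH [u' [u'K <- su']].
have sS : s \in S by apply: (subsetP KS).
have u'S : all (mem S) u' by apply: sub_all u'K; exact: subsetP.
have := len_simpleM (wprod u') sS; case: ifP => [invs e | _ e].
  have [u'' [u''K su'' u''E]] := exchange coxS u'K u'S invs.
  by exists u''; rewrite u''E in e *; split=> //; apply/eqP; rewrite -eqSS -su'' su' e.
by exists (s :: u'); rewrite /= sK u'K e su'.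
Qed.

Lemma par_ind K (Q : W -> Prop) : K \subset S -> Q 1 ->
  (forall s w, s \in K -> w \in <<K>> -> len S (s * w) = (len S w).+1 -> Q w -> Q (s * w)) ->
  {in <<K>>, forall w, Q w}.
Proof.
move=> KS Q1 QS w /(par_word KS) [u [uK <-]].
elim: u uK => [|s u IH] //= /andP[sK uK] su.
have uS : all (mem S) u by apply: sub_all uK; exact: subsetP.
have uw : wprod u \in <<K>>.
  elim: u uK {IH su uS} => [|x u IH] //= /andP[xK /IH]; apply: groupM.
  exact: mem_gen.
have sS : s \in S by apply: (subsetP KS).
have h1 := len_wprod uS; have h2 := lenM s (wprod u); rewrite (len_simple sS) in h2.
have e : size u = len S (wprod u) by apply/eqP; rewrite eqn_leq h1 andbT -ltnS su.
by apply: QS => //; [rewrite -su e | exact: IH].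
Qed.

Lemma par_descent K w : K \subset S -> w \in <<K>> -> w != 1 ->
  exists2 s, s \in K & (len S (s * w) < len S w)%N.
Proof.
move=> KS wK; move: w wK; apply: (par_ind KS) => [|s w sK _ e _ _]; first by rewrite eqxx.
by exists s => //; rewrite mulgA (simple_sqr coxS (subsetP KS s sK)) mul1g e.
Qed.

Lemma par_len1 K w : K \subset S -> w \in <<K>> -> len S w = 1%N -> w \in K.
Proof.
move=> KS /(par_word KS)[u [uK <- <-]].
by case: u uK => [|s [|t u]] //=; rewrite andbT mulg1.
Qed.

Lemma inv_par K w t : K \subset S -> w \in <<K>> -> inv S w t -> t \in <<K>>.
Proof.
move=> KS wK; move: w wK t; apply: (par_ind KS) => [t|s w sK wK _ IH t].
  by rewrite (inv1 coxS).
have sS : s \in S by apply: (subsetP KS).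
rewrite (invM coxS) (inv_simple coxS _ sS); case: eqP => [-> _|_ /= /IH h].
  exact: mem_gen.
by rewrite -(conjgK s t) groupJ ?groupV // mem_gen.
Qed.

Lemma card_inv w : #|[set t | inv S w t]| = len S w.
Proof.
have := mem_genS coxS w; move: w; apply: (par_ind (subxx S)) => [|s w sS _ e IH].
  by rewrite len1; apply/eqP; rewrite cards_eq0; apply/eqP/setP=> t; rewrite !inE (inv1 coxS).
rewrite e -IH.
(* Left multiplication by an ascent [s] conjugates the old inversions by [s] and adds [s] itself. *)
have <- : s |: [set t ^ s | t in [set t | inv S w t]] = [set t | inv S (s * w) t].
  apply/setP => t; rewrite !inE (invM coxS) (inv_simple coxS _ sS).
  have -> : (t \in [set t ^ s | t in [set t | inv S w t]]) = inv S w (t ^ s).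
    rewrite -{1}(conjgK s t) (simple_inv coxS sS) (mem_imset _ _ (@conjg_inj _ s)).
    by rewrite inE.
  case: eqP => // ->; rewrite conjgE mulKg inv_len //; lenlia.
rewrite cardsU1 (card_imset _ (@conjg_inj _ s)); case: imsetP => // -[t]; rewrite inE => tw ts.
have tE : t = s by apply: (@conjg_inj _ s); rewrite -ts conjgE mulKg.
by move: tw; rewrite tE inv_len // e; lenlia.
Qed.

(** Lengths add over a globally shortest element [x * d] of the coset. If [x] were not 1, a left
    descent [s] of [x^-1] would give [len (s * d) < len d], so local minimality already forces [d]
    to be the shortest. *)
Lemma len_min_coset K d : K \subset S -> {in K, forall s, (len S d < len S (s * d))%N} ->
  {in <<K>>, forall v, len S (v * d) = (len S v + len S d)%N}.
Proof.
move=> KS dmin.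
have ex : d \in [set v * d | v in <<K>>] by apply/imsetP; exists 1; rewrite ?mul1g.
case: (arg_minnP (len S) ex) => _ /imsetP[x xK ->] xmin {ex}.
have add : {in <<K>>, forall v, len S (v * (x * d)) = (len S v + len S (x * d))%N}.
  apply: (par_ind KS) => [|s v sK vK e IH]; first by rewrite mul1g len1.
  have sS := subsetP KS s sK.
  rewrite e addSn -IH -mulgA; have := len_simpleM (v * (x * d)) sS.
  rewrite (invM coxS) (inv_len v sS) e ltnNge leqnSn /=.
  case: ifP => // /andP[_]; rewrite ltnNge xmin // conjgE !mulgA.
  by apply/imsetP; eexists; last by []; rewrite !groupM ?groupV // mem_gen.
suff x1 : x = 1 by move=> v /add; rewrite x1 mul1g.
apply/eqP/negPn/negP => nx1.
have : x^-1 != 1 by rewrite invg_eq1.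
case/(par_descent KS (groupVr xK)) => s sK lts.
have e1 := add _ (groupVr xK); rewrite mulKg in e1.
have e2 := add _ (groupM (mem_gen sK) (groupVr xK)); rewrite -mulgA mulKg in e2.
by have := dmin s sK; rewrite e1 e2 ltn_add2r ltnNge ltnW.
Qed.

Lemma len_min_coset_r K d : K \subset S -> {in K, forall s, (len S d < len S (d * s))%N} ->
  {in <<K>>, forall v, len S (d * v) = (len S d + len S v)%N}.
Proof.
move=> KS dmin v vK; rewrite -lenV invMg (@len_min_coset K) ?groupV //.
  by rewrite !lenV addnC.
move=> s sK; rewrite lenV -(lenV (s * _)) invMg invgK (simple_inv coxS (subsetP KS s sK)).
exact: dmin.
Qed.

(** Induction on [v]: [s] is an inversion of [w] but not of [v], so by the cocycle rule [s ^ v] is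
    an inversion of [v^-1 * w], and removing [s * v] from [w] saves one more unit of length. *)
Lemma len_all_descents K w : K \subset S -> {in K, forall s, (len S (s * w) < len S w)%N} ->
  {in <<K>>, forall v, (len S v + len S (v^-1 * w) = len S w)%N}.
Proof.
move=> KS wmax; apply: (par_ind KS) => [|s v sK vK e IH].
  by rewrite len1 invg1 mul1g.
have sS := subsetP KS s sK.
have := invM coxS v (v^-1 * w) s; rewrite mulKVg !(inv_len _ sS) e wmax //.
rewrite ltnNge leqnSn /= => /esym /andP[_].
rewrite conjgE !mulgA mulgK => h; rewrite invMg (simple_inv coxS sS).
have := lenM (s * v) (v^-1 * s * w); rewrite !mulgA mulgK (simple_sqr coxS) // mul1g.
lenlia.
Qed.

(** * Longest elements of parabolic subgroups *)

Section Longest.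
Variable K : {set W}.
Hypothesis KS : K \subset S.
Let wK := longest S <<K>>.

Lemma longestP : wK \in <<K>> /\ {in <<K>>, forall v, (len S v <= len S wK)%N}.
Proof. by rewrite /wK /longest; case: arg_maxnP => // x xK h; split. Qed.

Lemma mem_longest : wK \in <<K>>. Proof. by case: longestP. Qed.

Lemma longest_add v : v \in <<K>> -> (len S v + len S (v^-1 * wK) = len S wK)%N.
Proof.
move: v; apply: (len_all_descents KS) => s sK; have sS := subsetP KS s sK.
rewrite len_simpleMN // -leqNgt; case: longestP => wKK; apply.
by rewrite groupM // mem_gen.
Qed.

Lemma longest_sqr : wK * wK = 1.
Proof.
have := longest_add (groupVr mem_longest); rewrite invgK lenV => h.
by apply: len_eq0; lenlia.
Qed.

Lemma longest_inv : wK^-1 = wK.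
Proof. by apply/eqP; rewrite eq_invg_mul longest_sqr. Qed.

Lemma len_Mlongest v : v \in <<K>> -> (len S (v * wK) + len S v = len S wK)%N.
Proof. by move=> vK; rewrite addnC -(lenV v) -{2}(invgK v) longest_add ?groupV. Qed.

Lemma len_longestM v : v \in <<K>> -> (len S (wK * v) + len S v = len S wK)%N.
Proof.
by move=> vK; rewrite -(lenV (wK * v)) invMg longest_inv -(lenV v) len_Mlongest ?groupV.
Qed.

Lemma len_longestJ v : v \in <<K>> -> len S (wK * v * wK) = len S v.
Proof.
move=> vK; have := len_Mlongest (groupM mem_longest vK); have := len_longestM vK; lenlia.
Qed.

Lemma longest_uniq v : v \in <<K>> -> len S v = len S wK -> v = wK.
Proof.
move=> vK e; have := len_Mlongest vK; rewrite e => h.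
have e1 : v * wK = 1 by apply: len_eq0; lenlia.
by apply: (mulIg wK); rewrite e1 longest_sqr.
Qed.

Lemma longestJ_simple s : s \in K -> wK * s * wK \in K.
Proof.
move=> sK; apply: (par_len1 KS); first by rewrite !groupM ?mem_longest // mem_gen.
by rewrite len_longestJ ?mem_gen // len_simple // (subsetP KS).
Qed.

End Longest.

(** Deodhar's lemma. If some [t] in [K] does not lengthen [s * w], comparing the four lengths of
    [w], [s * w], [w * t], [s * w * t] puts [lifting] in force, and [s * w = w * t]. *)
Lemma deodhar K s w : K \subset S -> s \in S -> w \in WKmin S K ->
  s * w \in WKmin S K \/ s * w \notin WKmin S K /\ w^-1 * s * w \in K.
Proof.
move=> KS sS; rewrite !inE => /forall_inP wmin.
have [|] := boolP [forall t in K, (len S (s * w) < len S (s * w * t))%N]; first by left.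
rewrite negb_forall => /existsP[t]; rewrite negb_imply -leqNgt => /andP[tK lt].
right; split=> //; have tS := subsetP KS t tK.
have h1 := wmin t tK; have h2 := len_Msimple (s * w) tS; have h3 := len_Msimple w tS.
have h4 := len_simpleM_or w sS; have h5 := len_simpleM_or (w * t) sS; rewrite mulgA in h5.
suff e : s * w = w * t by rewrite -mulgA e mulKg.
by apply: lifting => //; lenlia.
Qed.

End Length.

(** * Twisted involutions *)

Section Twisted.
Local Open Scope group_scope.
Variables (W : finGroupType) (S K : {set W}).
Hypotheses (coxS : coxeter_system S) (KS : K \subset S).
Implicit Types (s t v w : W) (z : W * {perm W}) (a : {perm W}).

Section AutK.
Variable a : {perm W}.
Hypothesis aK : a \in AutK K.

Lemma AutK_Aut : a \in Aut <<K>>.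
Proof. by move: aK; rewrite inE => /andP[]. Qed.

Lemma AutK_closed v : v \in <<K>> -> a v \in <<K>>.
Proof. by move=> vK; exact: (Aut_closed AutK_Aut vK). Qed.

Lemma AutKM : {in <<K>> &, {morph a : v w / v * w}}.
Proof. by apply/morphicP; exact: (Aut_morphic AutK_Aut). Qed.

Lemma AutK1 : a 1 = 1.
Proof. by apply: (mulgI (a 1)); rewrite -AutKM ?group1 // !mulg1. Qed.

Lemma AutKV v : v \in <<K>> -> a v^-1 = (a v)^-1.
Proof.
move=> vK; apply: (mulgI (a v)).
by rewrite -AutKM ?groupV // !mulgV AutK1.
Qed.

Lemma AutK_simple s : s \in K -> a s \in K.
Proof.
by move=> sK; move: aK; rewrite inE => /andP[_ /eqP <-]; rewrite imset_f.
Qed.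

Lemma AutK_len_le v : v \in <<K>> -> (len S (a v) <= len S v)%N.
Proof.
case/(par_word coxS KS) => u [uK <- <-].
suff [-> uS] : a (wprod u) = wprod (map a u) /\ all (mem S) (map a u).
  by rewrite -(size_map a u) len_wprod.
have : wprod u \in <<K>> by elim: u uK => //= s u IH /andP[sK /IH]; apply/groupM/mem_gen.
elim: u uK => [|s u IH] /=; first by rewrite AutK1.
case/andP=> sK uK suK; have sgK := mem_gen sK.
have ugK : wprod u \in <<K>> by rewrite -(groupMl _ sgK).
have [e uS] := IH uK ugK; split; first by rewrite AutKM // e.
by rewrite uS (subsetP KS) // AutK_simple.
Qed.

End AutK.

(** The condition [z^2 = 1] in the semidirect product, unfolded into components. It is the part of
    perfectness on which all length arguments rest. *)
Definition twisted z : Prop :=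
  [/\ z.1 \in <<K>>, z.2 \in AutK K, z.1 * z.2 z.1 = 1 & forall v, z.2 (z.2 v) = v].

Lemma refl_gen t : t \in refl K -> t \in <<K>>.
Proof.
by case/imset2P => v s vK sK ->; rewrite !groupM ?groupV // mem_gen.
Qed.

Lemma twistedV z : twisted z -> z.2 z.1 = z.1^-1.
Proof. by case=> _ _ e _; apply: (mulgI z.1); rewrite e mulgV. Qed.

(** Once [z^2 = 1], the square of [z t] has trivial automorphism part, so [(z t)^4 = 1] becomes a
    condition inside [W_K]. *)
Lemma IKP z : reflect (twisted z /\ {in refl K, forall t, (z.1 * z.2 t * z.1^-1 * t) ^+ 2 = 1})
  (z \in IK K).
Proof.
have key t : twisted z -> t \in refl K -> let u := sdmul z (t, 1) in
    sdmul (sdmul u u) (sdmul u u) = ((z.1 * z.2 t * z.1^-1 * t) ^+ 2, 1).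
  move=> tz /refl_gen tK /=; have zV := twistedV tz; case: tz => yK aK _ aa.
  have e2 : 1 * z.2 * (1 * z.2) = 1 :> {perm W}.
    by apply/permP => v; rewrite !permM !perm1 aa.
  rewrite /sdmul /= e2 mulg1 mul1g !perm1 AutKM ?AutK_closed //.
  by rewrite zV aa !mulgA expgS expg1 !mulgA.
rewrite inE; apply: (iffP and4P) => [[yK aK]|[tz zt]].
  case/eqP => e1 e2 /forall_inP h.
  have tz : twisted z by split=> // v; rewrite -permM e2 perm1.
  by split=> // t tK; have := h t tK; rewrite /= key // => /eqP[].
have [yK aK e1 e2] := tz; split=> //.
  apply/eqP; rewrite /sdmul e1; congr (_, _).
  by apply/permP => v; rewrite permM perm1.
by apply/forall_inP => t tK; rewrite /= key // zt.
Qed.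

Lemma zact_twisted z v : twisted z -> v \in <<K>> -> twisted (zact z v).
Proof.
move=> tz vK; have zV := twistedV tz; have [yK aK e aa] := tz.
have avK := AutK_closed aK vK.
split=> //=; first by rewrite !groupM ?groupV.
rewrite !(AutKM aK) ?groupM ?groupV // zV (AutKV aK) // aa.
by rewrite !mulgA mulgKV mulgK mulgV.
Qed.

Lemma zact_IK z v : z \in IK K -> v \in <<K>> -> zact z v \in IK K.
Proof.
case/IKP=> tz zt vK; apply/IKP; split; first exact: zact_twisted.
have [yK aK e aa] := tz; have avK := AutK_closed aK vK.
move=> t tK; have tgK := refl_gen tK.
have tvK : t ^ v \in refl K.
  case/imset2P: tK => x s xK sK ->; apply/imset2P; exists (v^-1 * x) s => //.
    by rewrite groupM ?groupV.
  by rewrite conjgE invMg invgK !mulgA.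
have := congr1 (conjg^~ v^-1) (zt _ tvK); rewrite conjXg conj1g => <-.
congr (_ ^+ 2); rewrite !conjgE /= !(AutKM aK, AutKV aK) ?groupM ?groupV //.
by rewrite !invMg !invgK !mulgA mulgK.
Qed.

Lemma zactM z v w : twisted z -> v \in <<K>> -> w \in <<K>> ->
  zact (zact z v) w = zact z (w * v).
Proof.
case=> yK aK _ _ vK wK; congr (_, _) => /=.
by rewrite (AutKM aK) // invMg !mulgA.
Qed.

Lemma zact1 z : twisted z -> zact z 1 = z.
Proof. by case: z => y a [_ aK _ _]; rewrite /zact /= (AutK1 aK) invg1 mulg1 mul1g. Qed.

Lemma twisted_len z v : twisted z -> v \in <<K>> -> len S (z.2 v) = len S v.
Proof.
case=> _ aK _ aa vK; apply/eqP; rewrite eqn_leq AutK_len_le //.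
by rewrite -{1}(aa v) AutK_len_le // AutK_closed.
Qed.

(** Inverting [s * y] and applying the automorphism gives [y * z.2 s], so these two have equal
    length. Either both steps of the twisted conjugation move the length in the same direction, or
    [lifting] shows that [y] is fixed. *)
Lemma zact_simple_cases z s : twisted z -> s \in K ->
  let y := z.1 in let y' := (zact z s).1 in
  if (len S (s * y) < len S y)%N
  then (s * y = y * z.2 s /\ y' = y) \/ len S y = (len S y').+2
  else (s * y = y * z.2 s /\ y' = y) \/ len S y' = (len S y).+2.
Proof.
move=> tz sK /=; have zV := twistedV tz; have [yK aK e aa] := tz.
have asK := AutK_simple aK sK; set y := z.1 in yK e zV *; set s' := z.2 s in asK *.
have sS := subsetP KS _ sK; have s'S := subsetP KS _ asK.
have sgK := mem_gen sK.
rewrite (simple_inv coxS s'S).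
have eqlen : len S (s * y) = len S (y * s').
  rewrite -(lenV coxS) invMg (simple_inv coxS sS) -zV.
  have -> : z.2 y * s = z.2 (y * s') by rewrite (AutKM aK) // ?aa // mem_gen.
  by rewrite (twisted_len tz) // groupM // mem_gen.
have done1 : s * y = y * s' -> s * y = y * s' /\ s * y * s' = y.
  by move=> h; split=> //; rewrite h -mulgA (simple_sqr coxS s'S) mulg1.
have h1 := len_simpleM_or coxS y sS.
have h2 := len_simpleM_or coxS (y * s') sS.
have h3 := len_Msimple coxS (s * y) s'S.
rewrite mulgA in h2.
case: ltnP => lt.
  have [lt2|] := ltnP (len S (s * y)) (len S (s * y * s')); last by right; lenlia.
  left; apply: done1.
  have := @lifting _ _ coxS s s' (s * y) sS s'S; rewrite !mulgA (simple_sqr coxS sS) mul1g.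
  move=> h; have h' : y = s * y * s' by apply: h; lenlia.
  by rewrite {2}h' -[RHS]mulgA (simple_sqr coxS s'S) mulg1.
have [lt2|] := ltnP (len S (s * y * s')) (len S (y * s')); last by right; lenlia.
by left; apply: done1; apply: (lifting coxS) => //; lenlia.
Qed.

(* In root language, [t] belongs to [fixinv z] when [z] maps the positive root
   of [t] to its opposite. *)
Definition fixinv z : {set W} := [set t | inv S z.1 t && (z.1 * z.2 t == t * z.1)].

Lemma card_fixinv_le z : (#|fixinv z| <= len S z.1)%N.
Proof.
rewrite -(card_inv coxS); apply: subset_leq_card.
by apply/subsetP => t; rewrite !inE => /andP[].
Qed.

(** Conjugation by [s] matches the two sets. For a reflection that [z] fixes up to sign, the flips
    due to [s] on the left and [z.2 s] on the right occur together, at [t = s], and cancel. *)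
Lemma card_fixinv_simple z s : twisted z -> s \in K -> #|fixinv (zact z s)| = #|fixinv z|.
Proof.
move=> tz sK; have tz' := zact_twisted tz (mem_gen sK).
have [yK aK _ aa] := tz; have [y'K _ _ _] := tz'.
have sS := subsetP KS _ sK; have asK := AutK_simple aK sK; have asS := subsetP KS _ asK.
have [sgK asgK] := (mem_gen sK, mem_gen asK).
suff fixJ t : (t \in fixinv (zact z s)) = (t ^ s \in fixinv z).
  rewrite -[RHS](card_imset _ (@conjg_inj _ s)); congr #|pred_of_set _|.
  apply/setP => t; rewrite fixJ -[in RHS](conjgK s t) (simple_inv coxS sS).
  by rewrite (mem_imset _ _ (@conjg_inj _ s)).
(* [z.2] is multiplicative only on [<<K>>], so elements outside are treated apart. *)
have outK x (z1 : W * {perm W}) : z1.1 \in <<K>> -> x \notin <<K>> -> x \in fixinv z1 = false.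
  by move=> zK; apply: contraNF; rewrite inE => /andP[/(inv_par coxS KS zK)].
have [tK|tnK] := boolP (t \in <<K>>); last by rewrite !outK ?groupJr.
rewrite !inE /=; set y := z.1 in yK y'K *; set r := t ^ s.
have rK : r \in <<K>> by rewrite groupJ.
have -> : (s * y * (z.2 s)^-1 * z.2 t == t * (s * y * (z.2 s)^-1)) = (y * z.2 r == r * y).
  rewrite /r conjgE !(AutKM aK, AutKV aK) ?groupM ?groupV //.
  rewrite -[RHS](can_eq (mulKg s)) -[RHS](can_eq (mulgK (z.2 s)^-1)).
  by rewrite !mulgA mulgK mulgV mul1g.
case: eqP => yr; rewrite ?andbF // !andbT.
have ry : r ^ y = z.2 r by rewrite conjgE -yr mulKg.
rewrite (simple_inv coxS asS) -mulgA !(invM coxS) (inv_simple coxS _ sS) -/r.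
rewrite (inv_simple coxS _ asS) ry (inj_eq perm_inj).
have -> : (r == s) = (t == s).
  have ss : s ^ s = s by rewrite conjgE mulKg.
  by rewrite -[in LHS]ss (inj_eq (@conjg_inj _ s)).
by case: (t == s); case: (inv _ _ _).
Qed.

Lemma card_fixinv z v : twisted z -> v \in <<K>> -> #|fixinv (zact z v)| = #|fixinv z|.
Proof.
move=> tz; move: v; apply: (par_ind coxS KS) => [|s v sK vK _ <-]; first by rewrite zact1.
by rewrite -zactM ?(mem_gen sK) // card_fixinv_simple //; apply: zact_twisted.
Qed.

(** By minimality every left descent [s] of [y] in [K] satisfies [s * y = y * z.2 s], and this
    spreads to the subgroup [<<D>>] generated by the descents. It then suffices that [y] lies in
    [<<D>>], since all its inversions do too. *)
Lemma fixinv_zminimal z : twisted z -> zminimal S K z -> #|fixinv z| = len S z.1.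
Proof.
move=> tz /forall_inP zmin; have [yK aK _ aa] := tz; set y := z.1 in yK *.
pose D := [set s in K | (len S (s * y) < len S y)%N].
have DK : D \subset K by apply/subsetP => s; rewrite inE => /andP[].
have DS := subset_trans DK KS; have DgK := subsetP (genS DK).
have comm : {in <<D>>, forall v, v * y = y * z.2 v}.
  apply: (par_ind coxS DS) => [|s v sD vD _ IH]; first by rewrite (AutK1 aK) mulg1 mul1g.
  have sK := subsetP DK s sD.
  rewrite (AutKM aK) ?(mem_gen sK) ?DgK // -mulgA IH !mulgA; congr (_ * _).
  have := zact_simple_cases tz sK; have := zmin s sK.
  by move: sD; rewrite inE sK /= => -> le [[]|] //; lenlia.
have ex : y \in [set v * y | v in <<D>>] by apply/imsetP; exists 1; rewrite ?mul1g.
case: (arg_minnP (len S) ex) => _ /imsetP[x xD ->] xmin {ex}.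
set d := x * y in xmin *.
have dmin : {in D, forall s, (len S d < len S (s * d))%N}.
  move=> s sD; have sS := subsetP DS s sD.
  have [->//|e] := len_simpleM_or coxS d sS.
  have := xmin (s * d); rewrite leqNgt e ltnSn => h; suff : false by []; apply: h.
  apply/imsetP; exists (s * x); first by rewrite groupM // mem_gen.
  by rewrite /d mulgA.
have xK := DgK _ xD.
(* [d] is the shortest element of the coset [<<D>> y]. A left descent [s] of [d] would also be one
   of [y = d * z.2 x^-1], hence lie in [D], where [d] has no descent. *)
have d1 : d = 1.
  apply/eqP/negPn/negP => nd1.
  have dK : d \in <<K>> by rewrite groupM.
  have [s sK lt] := par_descent coxS KS dK nd1.
  have ly := len_min_coset coxS DS dmin (groupVr xD); rewrite mulKg (lenV coxS) in ly.
  have sdE : s * y = s * d * z.2 x^-1.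
    by rewrite (AutKV aK) // /d (comm x xD) !mulgA mulgK.
  have := lenM coxS (s * d) (z.2 x^-1).
  rewrite -sdE (twisted_len tz) ?groupV // (lenV coxS) => le.
  have sD : s \in D by rewrite inE sK ly (leq_ltn_trans le) // addnC ltn_add2l.
  by have := dmin s sD; rewrite ltnNge ltnW.
have yD : y \in <<D>> by rewrite -(mulKg x y) -/d d1 mulg1 groupV.
rewrite -(card_inv coxS); congr #|pred_of_set _|; apply/setP => t; rewrite !inE.
case: (boolP (inv S z.1 t)) => //= it; rewrite -/y comm ?eqxx //.
exact: (inv_par coxS DS yD it).
Qed.

Lemma len_zmin z : twisted z -> len S (zmin S K z).1 = #|fixinv z|.
Proof.
move=> tz; rewrite /zmin; case: pickP => [x /andP[/imsetP[v vK ->] xmin]|nox] /=.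
  by rewrite -(fixinv_zminimal (zact_twisted tz vK) xmin) card_fixinv.
(* The default value in [zmin] is never reached: a shortest element of the orbit is [zminimal]. *)
have ex : z \in zorbit K z by apply/imsetP; exists 1; rewrite ?zact1.
case: (arg_minnP (fun x => len S x.1) ex) => _ /imsetP[v vK ->] vmin.
have /negP[] := nox (zact z v); apply/andP; split; first by apply/imsetP; exists v.
apply/forall_inP => s sK; apply: vmin.
by apply/imsetP; exists (s * v); rewrite ?zactM ?groupM // mem_gen.
Qed.

Lemma htE k : twisted k.2 -> ht S K k = (len S k.1 + (len S k.2.1 - #|fixinv k.2|)./2)%N.
Proof. by move=> tk; rewrite /ht len_zmin. Qed.

End Twisted.

(** * The action on pairs and its duality *)

Section Pairs.
Local Open Scope group_scope.
Variables (W : finGroupType) (S K : {set W}).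
Hypotheses (coxS : coxeter_system S) (KS : K \subset S).
Implicit Types (s t v w : W) (k : P W).

Lemma KK_twisted k : k \in KK S K -> twisted K k.2.
Proof. by rewrite inE => /andP[_ /IKP[]]. Qed.

Lemma len_WKminM w v : w \in WKmin S K -> v \in <<K>> -> len S (w * v) = (len S w + len S v)%N.
Proof. by rewrite inE => /forall_inP wmin; apply: len_min_coset_r. Qed.

Lemma sact_KK s k : s \in S -> k \in KK S K -> sact S K s k \in KK S K.
Proof.
rewrite /sact inE => sS /andP[kmin kI]; rewrite inE.
case: ifP => [->|h] //=; rewrite kmin zact_IK //.
by have [|[_ /mem_gen]] := deodhar coxS KS sS kmin; rewrite ?h.
Qed.

Lemma sactK s k : s \in S -> k \in KK S K -> sact S K s (sact S K s k) = k.
Proof.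
move=> sS kK; have tk := KK_twisted kK; move: kK; rewrite inE => /andP[kmin kI].
have [h|[/negbTE h /mem_gen tK]] := deodhar coxS KS sS kmin; rewrite /sact h /=.
  by rewrite mulgA (simple_sqr coxS sS) mul1g kmin; case: k {h kmin kI tk}.
rewrite h (zactM tk) // -!mulgA mulKVg (mulgA s) (simple_sqr coxS sS) mul1g mulVg (zact1 tk).
by case: k {h kmin kI tk tK}.
Qed.

Lemma ht_sact_cases s k : s \in S -> k \in KK S K ->
  [\/ ht S K (sact S K s k) = (ht S K k).+1, ht S K k = (ht S K (sact S K s k)).+1 |
      ht S K (sact S K s k) = ht S K k /\ s * k.1 \notin WKmin S K].
Proof.
move=> sS kK; have tk := KK_twisted kK; have tk' := KK_twisted (sact_KK sS kK).
rewrite !(htE coxS KS) //; move: kK; rewrite inE => /andP[kmin kI].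
rewrite /sact; case: ifP => /= h.
  by have [->|->] := len_simpleM_or coxS k.1 sS; rewrite addSn; [constructor 1|constructor 2].
have tK : k.1^-1 * s * k.1 \in K.
  by have [|[_ //]] := deodhar coxS KS sS kmin; rewrite ?h.
have := zact_simple_cases coxS KS tk tK; have := card_fixinv_simple coxS KS tk tK.
have := card_fixinv_le coxS k.2; have := card_fixinv_le coxS (zact k.2 (k.1^-1 * s * k.1)).
rewrite /=; set c := #|fixinv S k.2|; set c' := #|fixinv S _|; set y := len S k.2.1.
set y' := len S (_ * _ * _) => h1 h2 h3.
case: ifP => _ [[_ e]|e].
- by constructor 3; split=> //; rewrite h3 /y' e.
- by constructor 2; lia.
- by constructor 3; split=> //; rewrite h3 /y' e.
- by constructor 1; lia.
Qed.

(** A left descent of [k.1] keeps it in [WKmin] by Deodhar's lemma and would lower the height, so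
    [k.1 = 1]. Then [k.2] is [zminimal], and [fixinv_zminimal] makes the second term of the height
    vanish. *)
Lemma ht_local_min k : k \in KK S K ->
  (forall s, s \in S -> ~~ (ht S K (sact S K s k) < ht S K k)%N) -> ht S K k = 0%N.
Proof.
move=> kK kloc; have tk := KK_twisted kK; move: (kK); rewrite inE => /andP[kmin kI].
have k1 : k.1 = 1.
  apply/eqP/negPn/negP => nk1.
  have [s sS lt] := par_descent coxS (subxx S) (mem_genS coxS _) nk1.
  have sk : s * k.1 \in WKmin S K.
    have [//|[_ tK]] := deodhar coxS KS sS kmin.
    have := len_WKminM kmin (mem_gen tK); rewrite !mulgA mulgV mul1g; lenlia.
  by have := kloc s sS; rewrite /ht /sact sk /= ltn_add2r lt.
rewrite (htE coxS KS) // k1 (len1 S) add0n (fixinv_zminimal coxS KS tk) ?subnn //.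
apply/forall_inP => s sK; have sS := subsetP KS s sK.
have tks := KK_twisted (sact_KK sS kK).
have := kloc s sS; rewrite !(htE coxS KS) // /sact k1 !mulg1 invg1 mul1g.
have sn : s \in WKmin S K = false.
  apply/negP; rewrite inE => /forall_inP /(_ s sK).
  by rewrite (simple_sqr coxS sS) (len1 S).
rewrite sn /= (card_fixinv coxS KS tk (mem_gen sK)).
have := card_fixinv_le coxS (zact k.2 s); rewrite (card_fixinv coxS KS tk (mem_gen sK)).
have := zact_simple_cases coxS KS tk sK; rewrite -leqNgt /=.
by case: ifP => _ [[_ ->]|->] //; lenlia.
Qed.

End Pairs.

(** * The duality between pairs for [J] and pairs for [dualJ] *)

Section Dual.
Local Open Scope group_scope.
Variables (W : finGroupType) (S J : {set W}).
Hypotheses (coxS : coxeter_system S) (JS : J \subset S).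
Implicit Types (s t v w : W) (k : P W) (z : W * {perm W}).
Let o := w0 S.
Let p := longest S <<J>>.
Let J' := dualJ S J.

Lemma w0E : w0 S = longest S <<S>>.
Proof. by case: coxS => -> _ _. Qed.

Lemma w0_sqr : o * o = 1.
Proof. by rewrite /o w0E; apply: longest_sqr. Qed.

Lemma w0_inv : o^-1 = o.
Proof. by rewrite /o w0E; apply: longest_inv. Qed.

Lemma len_Mw0 v : (len S (v * o) + len S v = len S o)%N.
Proof. by rewrite /o w0E; apply: len_Mlongest => //; apply: mem_genS. Qed.

Lemma len_w0J v : len S (o * v * o) = len S v.
Proof. by rewrite /o w0E; apply: len_longestJ => //; apply: mem_genS. Qed.

Lemma w0J_simple s : s \in S -> o * s * o \in S.
Proof. by rewrite /o w0E => sS; apply: longestJ_simple. Qed.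

Lemma w0M v : o * (o * v) = v.
Proof. by rewrite mulgA w0_sqr mul1g. Qed.

Lemma dualJ_sub : J' \subset S.
Proof. by apply/subsetP => x /imsetP[s sJ ->]; apply/w0J_simple/(subsetP JS). Qed.

Lemma dualJE : J' = J :^ o.
Proof.
apply/setP => x; apply/imsetP/imsetP => -[s sJ ->]; exists s => //.
  by rewrite conjgE w0_inv mulgA.
by rewrite conjgE w0_inv mulgA.
Qed.

Lemma mem_dualJ v : (o * v * o \in <<J'>>) = (v \in <<J>>).
Proof. by rewrite dualJE genJ mem_conjg conjgE invgK w0_inv -!mulgA w0M w0_sqr mulg1. Qed.

Lemma dualJJ : dualJ S J' = J.
Proof.
apply/setP => x; apply/imsetP/idP => [[_ /imsetP[s sJ ->] ->]|xJ].
  by rewrite -/o -!mulgA w0M w0_sqr mulg1.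
exists (o * x * o); first by apply/imsetP; exists x.
by rewrite -/o -!mulgA w0M w0_sqr mulg1.
Qed.

Lemma dualJP v : v \in <<J'>> -> exists2 x, x \in <<J>> & v = o * x * o.
Proof.
move=> vJ; exists (o * v * o); last by rewrite -!mulgA w0M w0_sqr mulg1.
by rewrite -mem_dualJ -!mulgA w0M w0_sqr mulg1.
Qed.

Let pJ : p \in <<J>>. Proof. exact: mem_longest. Qed.
Let pp : p * p = 1. Proof. exact: longest_sqr. Qed.
Let pV : p^-1 = p. Proof. exact: longest_inv. Qed.
Let pM v : p * (p * v) = v. Proof. by rewrite mulgA pp mul1g. Qed.

Lemma twisted_longest z : twisted J z -> z.2 p = p.
Proof.
move=> tz; have [_ aJ _ _] := tz.
by apply: (longest_uniq coxS JS); rewrite ?AutK_closed // (twisted_len coxS JS tz).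
Qed.

(** [restr_perm] agrees with the composite only when that composite stabilises [<<J'>>], which is
    checked here; this formula then replaces the definition. *)
Lemma dualz_perm z x : twisted J z -> x \in <<J>> ->
  (dualz S J z).2 (o * x * o) = o * (p * z.2 x * p) * o.
Proof.
move=> tz xJ; have [_ aJ _ _] := tz.
have AdE v y : Ad v y = v * y * v^-1 by rewrite actpermE /= conjgE invgK mulgA.
have qE v : v \in <<J>> ->
    (Ad o * z.2 * Ad p * Ad o)%g (o * v * o) = o * (p * z.2 v * p) * o.
  move=> vJ; rewrite !permM !AdE w0_inv pV.
  by congr (_ * (_ * z.2 _ * _) * _); rewrite -!mulgA w0M w0_sqr mulg1.
rewrite /dualz /= restr_permE ?qE ?mem_dualJ //.
rewrite !inE; apply/subsetP => _ /dualJP[v vJ ->]; rewrite inE /= apermE qE // mem_dualJ.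
by rewrite !groupM ?AutK_closed.
Qed.

Lemma dualz_perm_out z x : x \notin <<J'>> -> (dualz S J z).2 x = x.
Proof. by apply: out_perm; apply: restr_perm_on. Qed.

Lemma dualz1 z : (dualz S J z).1 = o * (p * z.1) * o.
Proof. by rewrite /dualz /= -/o -/p !mulgA. Qed.

Lemma dualz_twisted z : twisted J z -> twisted J' (dualz S J z).
Proof.
move=> tz; have zV := twistedV tz; have zp := twisted_longest tz; have [yJ aJ e aa] := tz.
have zpM v : v \in <<J>> -> z.2 (p * v * p) = p * z.2 v * p.
  by move=> vJ; rewrite !(AutKM aJ) ?groupM // zp.
split.
- by rewrite dualz1 mem_dualJ groupM.
- rewrite inE; apply/andP; split.
    rewrite inE restr_perm_on; apply/morphicP => _ _ /dualJP[v vJ ->] /dualJP[w wJ ->].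
    have -> : o * v * o * (o * w * o) = o * (v * w) * o by rewrite -!mulgA w0M.
    rewrite !dualz_perm ?groupM // (AutKM aJ) //.
    by rewrite -!mulgA w0M pM.
  rewrite eqEcard (card_imset _ perm_inj) leqnn andbT.
  apply/subsetP => _ /imsetP[_ /imsetP[s sJ ->] ->].
  rewrite dualz_perm ?mem_gen //; apply/imsetP; exists (p * z.2 s * p) => //.
  by apply: longestJ_simple => //; apply: AutK_simple.
- rewrite dualz1 dualz_perm ?groupM // (AutKM aJ) // zp zV.
  by rewrite -!mulgA w0M !pM mulKVg pM w0_sqr.
- move=> x; have [/dualJP[v vJ ->]|xn] := boolP (x \in <<J'>>); last by rewrite !dualz_perm_out.
  rewrite !dualz_perm ?groupM ?AutK_closed // zpM ?AutK_closed // aa.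
  by rewrite -!mulgA !pM.
Qed.

Lemma dualz_zact z v : twisted J z -> v \in <<J>> ->
  dualz S J (zact z v) = zact (dualz S J z) (o * (p * v * p) * o).
Proof.
move=> tz vJ; have zp := twisted_longest tz; have [yJ aJ _ _] := tz.
congr (_, _); rewrite -[LHS]/(dualz S J (zact z v)).1 !dualz1.
rewrite dualz_perm ?groupM // !(AutKM aJ) ?groupM // zp /=.
by rewrite !invMg w0_inv !pV -!mulgA w0M !pM w0M.
Qed.

Lemma dualz_IK z : z \in IK J -> dualz S J z \in IK J'.
Proof.
case/IKP => tz zt; apply/IKP; split; first exact: dualz_twisted.
have zp := twisted_longest tz; have [yJ aJ _ _] := tz.
move=> _ /imset2P[_ _ /dualJP[v vJ ->] /imsetP[s sJ ->] ->].
have pvJ : (p * v * p) * (p * s * p) * (p * v * p)^-1 \in refl J.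
  by apply/imset2P; exists (p * v * p) (p * s * p); rewrite ?groupM ?longestJ_simple.
have := zt _ pvJ; set t := v * s * v^-1.
have tJ : t \in <<J>> by rewrite !groupM ?groupV ?(mem_gen sJ).
have -> : p * v * p * (p * s * p) * (p * v * p)^-1 = p * t * p.
  by rewrite !invMg !pV -!mulgA !pM.
have -> : w0 S * v * w0 S * (w0 S * s * w0 S) * (w0 S * v * w0 S)^-1 = o * t * o.
  by rewrite -/o !invMg !w0_inv -!mulgA !w0M.
(* Perfectness of the dual at [o t o] is perfectness of [z] at [p t p], conjugated by [p o]. *)
clearbody t => e; have := congr1 (conjg^~ (p * o)) e; rewrite conj1g conjXg => <-.
congr (_ ^+ 2); rewrite conjgE dualz1 dualz_perm // (AutKM aJ) ?groupM // (AutKM aJ) // zp.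
by rewrite !invMg !w0_inv !pV -!mulgA !(w0M, pM).
Qed.

Lemma dualk_KK k : k \in KK S J -> dualk S J k \in KK S J'.
Proof.
rewrite inE => /andP[kmin kI]; rewrite inE dualz_IK // andbT inE.
apply/forall_inP => _ /imsetP[s sJ ->] /=; rewrite -/o -/p.
(* [k.1 * p] is longest in its coset, and right multiplication by [w_0] reverses lengths. *)
have -> : k.1 * p * o * (o * s * o) = k.1 * (p * s) * o by rewrite -!mulgA w0M.
have h1 := len_Mw0 (k.1 * p); have h2 := len_Mw0 (k.1 * (p * s)).
have h3 := len_WKminM coxS JS kmin pJ.
have h4 := len_WKminM coxS JS kmin (groupM pJ (mem_gen sJ)).
have h5 := len_longestM coxS JS (mem_gen sJ).
have h6 := len_simple coxS (subsetP JS s sJ).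
lenlia.
Qed.

Lemma dualk_conj s k : (dualk S J k).1^-1 * s * (dualk S J k).1 =
  o * (p * (k.1^-1 * s * k.1) * p) * o.
Proof. by rewrite /= -/o -/p !invMg w0_inv pV !mulgA. Qed.

Lemma dualk_sact s k : s \in S -> k \in KK S J ->
  dualk S J (sact S J s k) = sact S J' s (dualk S J k).
Proof.
move=> sS kK; have tk := KK_twisted kK; have kK' := dualk_KK kK.
have skK' := dualk_KK (sact_KK coxS JS sS kK).
move: (kK); rewrite inE => /andP[kmin kI].
have [h|[h tJ]] := deodhar coxS JS sS kmin.
  move: skK'; rewrite /sact h inE /= => /andP[h' _].
  by move: h'; rewrite /dualk /= !mulgA => ->.
have tE := dualk_conj s k.
have tJ' : (dualk S J k).1^-1 * s * (dualk S J k).1 \in J'.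
  by rewrite tE; apply/imsetP; eexists; last by []; apply: longestJ_simple.
rewrite /sact (negbTE h); case: ifP => [h'|_]; last first.
  by rewrite /dualk /= dualz_zact ?mem_gen // -tE.
(* If [s * w] were minimal as well as [w], then [t = w^-1 s w] in [J'] would lengthen [w] to [s * w]
   and also [s * w] back to [w]. *)
move: kK' h'; rewrite inE => /andP[kmin' _]; move: tJ' kmin'.
move: (dualk S J k).1 => w tJ'; rewrite !inE => /forall_inP/(_ _ tJ') lt1 /forall_inP/(_ _ tJ').
have -> : s * w * (w^-1 * s * w) = w by rewrite !mulgA mulgK (simple_sqr coxS sS) mul1g.
move: lt1; have -> : w * (w^-1 * s * w) = s * w by rewrite !mulgA mulgV mul1g.
by move=> lt1; rewrite ltnNge ltnW.
Qed.

Lemma dualk_inj : {in KK S J &, injective (dualk S J)}.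
Proof.
move=> [w [y a]] [w' [y' a']] kK kK' [/mulIg/mulIg ew /mulIg/mulgI ey ea].
have tz := KK_twisted kK; have tz' := KK_twisted kK'.
have [_ aJ _ _] := tz; have [_ aJ' _ _] := tz'.
congr (_, (_, _)) => //; apply/permP => x.
have [xJ|xJ] := boolP (x \in <<J>>).
  have := congr1 (fun b : {perm W} => b (o * x * o)) ea.
  by rewrite (dualz_perm tz) // (dualz_perm tz') //= => /mulIg/mulgI/mulIg/mulgI.
by rewrite !(out_Aut _ xJ) // AutK_Aut.
Qed.

(** First components of dual pairs have lengths with constant sum, and so do second components.
    Since [fixinv] has constant size along each class, the gain on one side is the loss on the
    other. *)
Lemma ht_dualk_sact s k : s \in S -> k \in KK S J ->
  (ht S J (sact S J s k) + ht S J' (dualk S J (sact S J s k)) =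
   ht S J k + ht S J' (dualk S J k))%N.
Proof.
move=> sS kK; have skK := sact_KK coxS JS sS kK.
have [tk tsk] := (KK_twisted kK, KK_twisted skK).
have [tk' tsk'] := (dualz_twisted tk, dualz_twisted tsk).
have JS' := dualJ_sub.
rewrite !(htE coxS JS) // !(htE coxS JS') //.
have dlen k1 : k1 \in KK S J -> (len S (dualk S J k1).1 + len S k1.1 + len S p = len S o)%N.
  rewrite inE => /andP[k1min _].
  by have := len_Mw0 (k1.1 * p); rewrite (len_WKminM coxS JS k1min pJ) /= -/o -/p; lenlia.
have zlen k1 : k1 \in KK S J -> (len S (dualk S J k1).2.1 + len S k1.2.1 = len S p)%N.
  case/KK_twisted => yJ _ _ _; rewrite -[(dualk S J k1).2]/(dualz S J k1.2) dualz1 len_w0J.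
  exact: len_longestM.
have := zlen _ kK; have := zlen _ skK; have := dlen _ kK; have := dlen _ skK.
move: (kK); rewrite inE => /andP[kmin _].
have [h|[h tJ]] := deodhar coxS JS sS kmin.
  have -> : (sact S J s k).2 = k.2 by rewrite /sact h.
  have -> : (dualk S J (sact S J s k)).2 = (dualk S J k).2 by rewrite /sact h.
  lia.
have tE : sact S J s k = (k.1, zact k.2 (k.1^-1 * s * k.1)) by rewrite /sact (negbTE h).
have c' : #|fixinv S (dualk S J (sact S J s k)).2| = #|fixinv S (dualk S J k).2|.
  rewrite tE /= dualz_zact ?mem_gen // (card_fixinv coxS JS') //.
  by rewrite mem_dualJ (groupM (groupM pJ (mem_gen tJ)) pJ).
have := card_fixinv_le coxS (dualk S J (sact S J s k)).2; rewrite c'.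
have := card_fixinv_le coxS (dualk S J k).2.
have := card_fixinv_le coxS (sact S J s k).2.
have := card_fixinv_le coxS k.2.
have -> : #|fixinv S (sact S J s k).2| = #|fixinv S k.2|.
  by rewrite tE (card_fixinv_simple coxS JS tk tJ).
have -> : (sact S J s k).1 = k.1 by rewrite tE.
have : [\/ len S (sact S J s k).2.1 = len S k.2.1,
           len S (sact S J s k).2.1 = (len S k.2.1).+2 |
           len S k.2.1 = (len S (sact S J s k).2.1).+2].
  rewrite tE; have := zact_simple_cases coxS JS tk tJ => /=.
  by case: ifP => _ [[_ ->]|->]; constructor.
(* Raising a length by 2 raises the halved difference by 1 whatever its parity; the bound keeps the
   truncated subtraction exact. *)
have half2 a c : (c <= a)%N -> ((a.+2 - c)./2 = (a - c)./2.+1)%N.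
  by move=> ca; rewrite !subSn // leqW.
move=> cases c1 c2 c3 c4 d1 d2 z1 z2.
have -> : len S (dualk S J (sact S J s k)).1 = len S (dualk S J k).1 by lia.
case: cases => e.
- have -> : len S (dualk S J (sact S J s k)).2.1 = len S (dualk S J k).2.1 by lia.
  by rewrite e.
- have -> : len S (dualk S J k).2.1 = (len S (dualk S J (sact S J s k)).2.1).+2 by lia.
  by rewrite e !half2 // !addnS !addSn.
- have -> : len S (dualk S J (sact S J s k)).2.1 = (len S (dualk S J k).2.1).+2 by lia.
  by rewrite e !half2 // !addnS !addSn.
Qed.

End Dual.

(** * Laurent polynomials *)

Section Laurent.
Local Open Scope ring_scope.

Lemma toLFM p q : toLF (p * q) = toLF p * toLF q. Proof. exact: rmorphM. Qed.
Lemma toLFD p q : toLF (p + q) = toLF p + toLF q. Proof. exact: rmorphD. Qed.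
Lemma toLFXn n : toLF 'X^n = X ^+ n. Proof. exact: rmorphXn. Qed.
Lemma toLFC (c : int) : toLF c%:P = c%:~R.
Proof. by rewrite -{1}[c]intz (rmorph_int (@polyC int)) /toLF rmorph_int. Qed.
Lemma toLFZ (c : int) p : toLF (c *: p) = c%:~R * toLF p.
Proof. by rewrite -mul_polyC toLFM toLFC. Qed.
Lemma toLF_inj : injective toLF.
Proof. by move=> p q /eqP; rewrite tofrac_eq => /eqP. Qed.

Lemma X_neq0 : X != 0 :> LF.
Proof. by rewrite /X /toLF tofrac_eq0 polyX_eq0. Qed.
Local Hint Resolve X_neq0 : core.

Lemma Xn_neq0 n : X ^+ n != 0 :> LF. Proof. exact: expf_neq0. Qed.
Local Hint Resolve Xn_neq0 : core.

Lemma LF_two : (2 : LF) != 0.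
Proof.
have -> : (2 : LF) = toLF 2 by rewrite /toLF rmorphMn.
by rewrite /toLF tofrac_eq0 -polyC_natr polyC_eq0.
Qed.

Lemma pbarE p : pbar p = (map_poly intr p).[X^-1].
Proof.
rewrite (horner_coef_wide _ (size_poly _ _)) /pbar.
by apply: eq_bigr => i _; rewrite coef_map exprVn.
Qed.

Lemma pbarD p q : pbar (p + q) = pbar p + pbar q.
Proof. by rewrite !pbarE rmorphD hornerD. Qed.

Lemma pbarM p q : pbar (p * q) = pbar p * pbar q.
Proof. by rewrite !pbarE rmorphM hornerM. Qed.

Lemma pbarC c : pbar c%:P = c%:~R.
Proof. by rewrite pbarE map_polyC hornerC. Qed.

Lemma pbarXn n : pbar 'X^n = X ^- n.
Proof. by rewrite pbarE map_polyXn hornerXn exprVn. Qed.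

(* The graph of the involution [X -> X^-1] on Laurent polynomials. *)
Definition cbar (a b : LF) : Prop :=
  exists (n : nat) (p : {poly int}), a = toLF p / X ^+ n /\ b = pbar p * X ^+ n.

Lemma cbar_fun a b b' : cbar a b -> cbar a b' -> b = b'.
Proof.
case=> n [p [-> ->]] [k [q [e ->]]].
have e1 : p * 'X^k = q * 'X^n.
  by apply: toLF_inj; rewrite !toLFM !toLFXn; apply/eqP; rewrite -eqr_div // e.
have := congr1 pbar e1; rewrite !pbarM !pbarXn => e2.
by apply/eqP; rewrite -[X ^+ n]invrK -[X ^+ k]invrK eqr_div ?invr_eq0 // e2.
Qed.

Lemma cbarM a b a' b' : cbar a b -> cbar a' b' -> cbar (a * a') (b * b').
Proof.
case=> n [p [-> ->]] [k [q [-> ->]]]; exists (n + k)%N, (p * q).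
by rewrite toLFM pbarM exprD mulf_div mulrACA.
Qed.

Lemma cbarD a b a' b' : cbar a b -> cbar a' b' -> cbar (a + a') (b + b').
Proof.
case=> n [p [-> ->]] [k [q [-> ->]]]; exists (n + k)%N, (p * 'X^k + q * 'X^n).
rewrite toLFD pbarD !toLFM !pbarM !toLFXn !pbarXn addf_div // exprD; split=> //.
by rewrite mulrDl -!mulrA mulKf // [X ^+ n * _]mulrC mulKf // mulrC.
Qed.

Lemma cbarC (c : int) : cbar c%:~R c%:~R.
Proof.
exists 0%N, c%:P; rewrite pbarC expr0 mulr1 divr1; split=> //.
by rewrite toLFC.
Qed.

Lemma cbar0 : cbar 0 0. Proof. exact: (cbarC 0). Qed.
Lemma cbar1 : cbar 1 1. Proof. exact: (cbarC 1). Qed.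

Lemma cbarN a b : cbar a b -> cbar (- a) (- b).
Proof. by move=> h; rewrite -[- a]mulN1r -[- b]mulN1r; apply: cbarM => //; apply: (cbarC (-1)). Qed.

Lemma cbar_sign k a b : cbar a b -> cbar ((-1) ^+ k * a) ((-1) ^+ k * b).
Proof.
by rewrite -signr_odd; case: odd; rewrite ?mulN1r ?mul1r //; apply: cbarN.
Qed.

Lemma cbarX : cbar X X^-1.
Proof. by exists 0%N, 'X; rewrite expr0 divr1 mulr1 -['X]expr1 pbarXn expr1. Qed.

Lemma cbarXV : cbar X^-1 X.
Proof. by exists 1%N, 1; rewrite -polyC1 pbarC /toLF rmorph1 !mul1r. Qed.

Lemma cbar_sum (I : finType) (f g : I -> LF) :
  (forall i, cbar (f i) (g i)) -> cbar (\sum_i f i) (\sum_i g i).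
Proof.
move=> fg; apply: (big_ind2 cbar) => // [|a b a' b']; first exact: cbar0.
exact: cbarD.
Qed.

Lemma laurent_neg_cbar f : laurent_neg f -> exists g, cbar f g.
Proof. by case=> n [q [_ ->]]; exists (pbar q * X ^+ n), n, q. Qed.

Lemma laurent_neg0 : laurent_neg 0.
Proof. by exists 0%N, 0; rewrite size_poly0 /toLF rmorph0 mul0r. Qed.

Lemma laurent_negD f g : laurent_neg f -> laurent_neg g -> laurent_neg (f + g).
Proof.
case=> n [p [pn ->]] [k [q [qk ->]]]; exists (n + k)%N, (p * 'X^k + q * 'X^n); split.
  have szX (a : {poly int}) i j : (size a <= i -> size (a * 'X^j)%R <= i + j)%N.
    move=> ai; apply: leq_trans (size_polyMleq _ _) _.
    by rewrite size_polyXn addnS leq_add2r.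
  rewrite (leq_trans (size_polyD _ _)) // geq_max szX //=.
  by rewrite addnC szX.
by rewrite toLFD !toLFM !toLFXn addf_div // exprD.
Qed.

Lemma laurent_negM f g : laurent_neg f -> laurent_neg g -> laurent_neg (f * g).
Proof.
case=> n [p [pn ->]] [k [q [qk ->]]]; exists (n + k)%N, (p * q); split.
  by rewrite (leq_trans (size_polyMleq _ _)) // (leq_trans (leq_pred _)) // leq_add.
by rewrite toLFM exprD mulf_div.
Qed.

Lemma laurent_neg_sign k f : laurent_neg f -> laurent_neg ((-1) ^+ k * f).
Proof.
rewrite -signr_odd; case: odd; rewrite ?mulN1r ?mul1r //.
case=> n [p [pn ->]]; exists n, (- p); rewrite size_polyN; split=> //.
by rewrite /toLF rmorphN mulNr.
Qed.

Lemma laurent_neg_sum (I : finType) (f : I -> LF) :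
  (forall i, laurent_neg (f i)) -> laurent_neg (\sum_i f i).
Proof.
move=> hf; apply: (big_ind laurent_neg) => //; first exact: laurent_neg0.
exact: laurent_negD.
Qed.

(** Invariance puts [f] in both [x^-1 Z[x^-1]] and [x Z[x]]. After clearing denominators, [q] has
    exponents below [n], while its reversal [r] has only exponents above [n]. *)
Lemma laurent_neg_selfbar f : laurent_neg f -> cbar f f -> f = 0.
Proof.
case=> n [q [qn ->]] ff.
have e : toLF q / X ^+ n = pbar q * X ^+ n by apply: cbar_fun ff _; exists n, q.
pose r : {poly int} := \sum_(i < size q) q`_i *: 'X^(n + n - i).
have qr : q = r.
  apply: toLF_inj; have -> : toLF q = pbar q * X ^+ (n + n).
    by rewrite exprD mulrA -e divfK.
  rewrite [RHS]rmorph_sum /pbar mulr_suml; apply: eq_bigr => i _.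
  have iq := leq_trans (ltn_ord i) qn.
  rewrite -[RHS]/(toLF (_ *: _)) toLFZ toLFXn -mulrA; congr (_ * _).
  by rewrite -[in LHS](subnK (leq_trans (ltnW iq) (leq_addr n n))) exprD mulrA mulrAC mulVf // mul1r.
suff -> : q = 0 by rewrite /toLF rmorph0 mul0r.
apply/polyP => j; rewrite coef0; have [nj|jn] := leqP n j.
  by rewrite nth_default // (leq_trans qn).
rewrite qr coef_sum big1 // => i _; rewrite coefZ coefXn.
have -> : (j == n + n - i)%N = false by have := leq_trans (ltn_ord i) qn; lia.
by rewrite mulr0.
Qed.

End Laurent.

(** * Hecke operators and the pairing *)

(** Both eigenvalues of [H_s] are roots of its quadratic relation. *)
Lemma quadratic_root (F : fieldType) (x : F) (b : bool) :
  (x != 0 -> (if b then - x^-1 else x) * (if b then - x^-1 else x)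
     - (x - x^-1) * (if b then - x^-1 else x) = 1)%R.
Proof. by case: b => x0; field. Qed.

Lemma adjoint_desc (R : comNzRingType) (q a b c e : R) :
  ((a + q * b) * c + b * (e - q * c) = a * c + b * e)%R.
Proof. by ring. Qed.

Lemma adjoint_eq (R : comNzRingType) (x y f g : R) (b : bool) :
  ((if b then - y else x) * f * g + f * ((if ~~ b then - y else x) * g - (x - y) * g) = 0)%R.
Proof. by case: b => /=; ring. Qed.

(* Stated over an abstract ring: conversion problems in [LF] may diverge. *)
Lemma hecke_sum (R : comNzRingType) (A : finType) (h : A -> nat) (act : A -> A)
    (neg : A -> bool) (x y : R) (f : A -> R) (u : A) : involutive act ->
  (\sum_t f t * (if (h t < h (act t))%N then (u == act t)%:R
     else if (h (act t) < h t)%N then (u == act t)%:R + (x - y) * (u == t)%:R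
     else if neg t then - y * (u == t)%:R else x * (u == t)%:R) =
   if (h u < h (act u))%N then f (act u)
   else if (h (act u) < h u)%N then f (act u) + (x - y) * f u
   else (if neg u then - y else x) * f u)%R.
Proof.
move=> actK; pose c t : R := (if (h t < h (act t))%N then (u == act t)%:R
  else if (h (act t) < h t)%N then (u == act t)%:R + (x - y) * (u == t)%:R
  else if neg t then - y * (u == t)%:R else x * (u == t)%:R)%R.
rewrite (eq_bigr (fun t => f t * c t)%R) //.
have far t : t != u -> t != act u -> c t = 0%R.
  move=> tu tau; rewrite /c [u == t]eq_sym (negbTE tu) !mulr0 addr0.
  have -> : (u == act t) = false by apply: contraNF tau => /eqP ->; rewrite actK.
  by do !case: ifP => _.
rewrite (bigD1 u) //=; have [e|aun] := eqVneq (act u) u.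
  rewrite big1 => [|t tu]; last by rewrite far ?mulr0 // e.
  by rewrite /c e !ltnn eqxx !mulr1 addr0 mulrC; case: ifP.
rewrite (bigD1 (act u)) //= big1 => [|t /andP[tu tau]]; last by rewrite far ?mulr0.
rewrite /c actK !eqxx [u == act u]eq_sym (negbTE aun) !mulr0 !mulr1 !addr0 add0r.
case: (ltngtP (h u) (h (act u))) => _ /=.
- by rewrite mulr0 add0r mulr1.
- by rewrite mulr1 addrC mulrC.
- by rewrite if_same mulr0 addr0 mulrC.
Qed.

Section Hecke.
Local Open Scope ring_scope.
Variables (A : finType) (h : A -> nat) (act : A -> A) (neg : A -> bool).
Hypothesis actK : involutive act.
Implicit Types (f g : {ffun A -> LF}) (a u : A).

(** The operator [H_s] on coefficient functions. Its matrix in the standard basis is symmetric, so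
    the formula has the same shape as on basis vectors. *)
Definition hecke f : {ffun A -> LF} :=
  [ffun u => if (h u < h (act u))%N then f (act u)
             else if (h (act u) < h u)%N then f (act u) + (X - X^-1) * f u
             else (if neg u then - X^-1 else X) * f u].

(** The inverse of [H_s], as the quadratic relation gives it. *)
Definition heckeV f : {ffun A -> LF} := [ffun u => hecke f u - (X - X^-1) * f u].

Definition ind a : {ffun A -> LF} := [ffun u => (u == a)%:R].

Lemma hecke_root u (c := if neg u then - X^-1 else X : LF) : c * c - (X - X^-1) * c = 1.
Proof.
exact: quadratic_root X_neq0. Qed.

Lemma heckeK f : hecke (heckeV f) = f.
Proof.
apply/ffunP => u; rewrite ffunE !ffunE actK; have root := hecke_root u.
case: (ltngtP (h u) (h (act u))) => huu /=.
- by rewrite addrK.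
- by rewrite addrK subrK.
- by rewrite -mulrBl mulrA mulrBr [_ * (X - _)]mulrC root mul1r.
Qed.

Lemma heckeVK f : heckeV (hecke f) = f.
Proof.
apply/ffunP => u; rewrite ffunE !ffunE actK; have root := hecke_root u.
case: (ltngtP (h u) (h (act u))) => huu /=.
- by rewrite addrK.
- by rewrite addrK.
- by rewrite !mulrA -mulrBl root mul1r.
Qed.

Lemma hecke_ind a : (h (act a) < h a)%N -> ind a = hecke (ind (act a)).
Proof.
move=> ha; apply/ffunP => u; rewrite !ffunE (inj_eq (can_inj actK)).
case: ltngtP => huu //=.
- case: (u =P act a) => [e|_]; last by rewrite mulr0 addr0.
  by move: huu; rewrite e actK ltnNge ltnW.
- case: (u =P act a) => [e|_]; first by move: huu ha; rewrite e actK => ->; rewrite ltnn.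
  by rewrite mulr0; case: eqP => // e; move: huu ha; rewrite e => ->; rewrite ltnn.
Qed.

End Hecke.

Section SemiLinear.
Local Open Scope ring_scope.
Variables (A : finType) (bar : {ffun A -> LF} -> {ffun A -> LF}).
Hypothesis barD : forall f g, bar (f + g) = bar f + bar g.
Hypothesis barZ : forall a b (f : {ffun A -> LF}), cbar a b ->
  bar [ffun u => a * f u] = [ffun u => b * bar f u].

(** Antilinearity concerns Laurent polynomial scalars, not all of [LF], so the conjugate
    coefficients are supplied as a function [g]. *)
Lemma bar_expand (f g : {ffun A -> LF}) : (forall u, cbar (f u) (g u)) ->
  forall k, bar f k = \sum_u g u * bar (ind u) k.
Proof.
move=> fg k; have bar0 : bar 0 = 0 by apply: (addrI (bar 0)); rewrite -barD !addr0.
have {1}-> : f = \sum_u [ffun v => f u * ind u v].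
  apply/ffunP => v; rewrite sum_ffunE (bigD1 v) //= big1 ?addr0.
    by rewrite !ffunE eqxx mulr1.
  by move=> u uv; rewrite !ffunE eq_sym (negbTE uv) mulr0.
rewrite (big_morph bar barD bar0) sum_ffunE; apply: eq_bigr => u _.
by rewrite (barZ _ (fg u)) ffunE.
Qed.

End SemiLinear.

(** * The pairing of two dual modules, over abstract index sets *)

Section Pairing.
Local Open Scope ring_scope.
Variables (A B I : finType) (d : A -> B).
Variables (hA : A -> nat) (sA : I -> A -> A) (nA : I -> A -> bool).
Variables (hB : B -> nat) (sB : I -> B -> B) (nB : I -> B -> bool).
Variables (bA : {ffun A -> LF} -> {ffun A -> LF}) (bB : {ffun B -> LF} -> {ffun B -> LF}).
Variables (m : A -> A -> LF) (n : B -> B -> LF).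

Hypothesis sAK : forall s, involutive (sA s).
Hypothesis sBK : forall s, involutive (sB s).
Hypothesis d_bij : bijective d.
Hypothesis dS : forall s a, d (sA s a) = sB s (d a).
Hypothesis h_sum : forall s a, (hA (sA s a) + hB (d (sA s a)) = hA a + hB (d a))%N.
Hypothesis h_step : forall s a, (hA a < hA (sA s a))%N -> hA (sA s a) = (hA a).+1.
Hypothesis n_dual : forall s a, hA (sA s a) = hA a -> nB s (d a) = ~~ nA s a.
Hypothesis h_min : forall b, (forall s, ~~ (hB (sB s b) < hB b)%N) -> hB b = 0%N.

Let TA s := hecke hA (sA s) (nA s).
Let TB s := hecke hB (sB s) (nB s).
Let VA s := heckeV hA (sA s) (nA s).
Let VB s := heckeV hB (sB s) (nB s).

Hypothesis bAD : forall f g, bA (f + g) = bA f + bA g.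
Hypothesis bAZ : forall a b (f : {ffun A -> LF}), cbar a b ->
  bA [ffun u => a * f u] = [ffun u => b * bA f u].
Hypothesis bAT : forall s f, TA s (bA (TA s f)) = bA f.
Hypothesis bBD : forall f g, bB (f + g) = bB f + bB g.
Hypothesis bBZ : forall a b (f : {ffun B -> LF}), cbar a b ->
  bB [ffun u => a * f u] = [ffun u => b * bB f u].
Hypothesis bBT : forall s f, TB s (bB (TB s f)) = bB f.
Hypothesis bB_min : forall b, (forall s, ~~ (hB (sB s b) < hB b)%N) -> bB (ind b) = ind b.

Hypothesis m_bar : forall t, bA [ffun u => m u t] = [ffun u => m u t].
Hypothesis m1 : forall t, m t t = 1.
Hypothesis m_neg : forall u t, u != t -> laurent_neg (m u t).
Hypothesis m_tri : forall u t, u != t -> m u t != 0 ->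
  (hA u < hA t)%N /\ (hA u + hB (d u) = hA t + hB (d t))%N.
Hypothesis n_bar : forall t, bB [ffun u => n u t] = [ffun u => n u t].
Hypothesis n1 : forall t, n t t = 1.
Hypothesis n_neg : forall u t, u != t -> laurent_neg (n u t).
Hypothesis n_tri : forall u t, u != t -> n u t != 0 -> (hB u < hB t)%N.

Let pr (f : {ffun A -> LF}) (g : {ffun B -> LF}) : LF := \sum_a (-1) ^+ hA a * (f a * g (d a)).

(** The summand [F] of the difference vanishes where [s] keeps the height, the eigenvalues being
    exchanged. Elsewhere it is symmetric in [a] and [sA s a] up to the sign of a height step, so the
    total equals its own negative. *)
Lemma pr_adjoint s f g : pr (TA s f) g = - pr f (VB s g).
Proof.
pose F a := (-1) ^+ hA a * (TA s f a * g (d a) + f a * VB s g (d a)) : LF.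
suff F0 : \sum_a F a = 0.
  apply/eqP; rewrite -addr_eq0 -F0 -big_split /=; apply/eqP.
  by apply: eq_bigr => a _; rewrite -mulrDr.
have FE a : F a = if hA (sA s a) == hA a then 0
    else (-1) ^+ hA a * (f (sA s a) * g (d a) + f a * g (d (sA s a))).
  rewrite /F !ffunE -dS; have := h_sum s a; have := @n_dual s a.
  case: (ltngtP (hA a) (hA (sA s a))) => ha nd hs /=.
  - have -> : (hB (d a) < hB (d (sA s a)))%N = false by lia.
    have -> : (hB (d (sA s a)) < hB (d a))%N by lia.
    by rewrite addrK.
  - have -> : (hB (d a) < hB (d (sA s a)))%N by lia.
    congr (_ * _).
    exact: adjoint_desc.
  - rewrite nd //; have -> : hB (d a) = hB (d (sA s a)) by lia.
    by rewrite !ltnn adjoint_eq mulr0.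
have FS a : F (sA s a) = - F a.
  rewrite !FE sAK [in LHS]eq_sym; case: eqP => [_|/eqP ne]; first by rewrite oppr0.
  rewrite addrC -mulNr [f (sA s a) * _]mulrC [f a * _]mulrC.
  rewrite [g _ * f (sA s a)]mulrC [g _ * f a]mulrC; congr (_ * _).
  case: (ltngtP (hA a) (hA (sA s a))) ne => // ha _.
    by rewrite (h_step ha) exprS mulN1r.
  have := @h_step s (sA s a); rewrite sAK => /(_ ha) ->.
  by rewrite exprS mulN1r opprK.
have e : \sum_a F a = - \sum_a F a.
  rewrite {1}(reindex_inj (can_inj (sAK s))) /= -sumrN.
  by apply: eq_bigr => a _; rewrite FS.
move/eqP: e; rewrite -addr_eq0 -mulr2n -mulr_natl mulf_eq0 (negbTE LF_two) /=.
by move/eqP.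
Qed.

Lemma m_cbar t : exists mb : A -> LF, forall u, cbar (m u t) (mb u).
Proof.
apply: (@fin_all_exists A (fun=> LF) (fun u => cbar (m u t))) => u; have [->|ut] := eqVneq u t.
  by exists 1; rewrite m1; apply: cbar1.
exact/laurent_neg_cbar/m_neg.
Qed.

Lemma n_cbar t : exists nb : B -> LF, forall u, cbar (n u t) (nb u).
Proof.
apply: (@fin_all_exists B (fun=> LF) (fun u => cbar (n u t))) => u; have [->|ut] := eqVneq u t.
  by exists 1; rewrite n1; apply: cbar1.
exact/laurent_neg_cbar/n_neg.
Qed.

(** Triangularity of the canonical basis passes to the bar operator: bar invariance of the canonical
    element at [t] is solved for [bA (ind t)], by induction on height. *)
Lemma bar_ind_tri t : bA (ind t) t = 1 /\ forall u, u != t -> bA (ind t) u != 0 ->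
  (hA u < hA t)%N /\ (hA u + hB (d u) = hA t + hB (d t))%N.
Proof.
have [N] := ubnP (hA t); elim: N t => // N IH t; rewrite ltnS => tN.
have [mb mbP] := m_cbar t.
have mbt : mb t = 1 by apply: cbar_fun (mbP t) _; rewrite m1; apply: cbar1.
have mb0 u : m u t = 0 -> mb u = 0.
  by move=> e; apply: cbar_fun (mbP u) _; rewrite e; apply: cbar0.
have expand k : m k t = bA (ind t) k + \sum_(u | u != t) mb u * bA (ind u) k.
  have := @bar_expand _ _ bAD bAZ [ffun u => m u t] [ffun u => mb u] _ k.
  rewrite m_bar ffunE => -> => [|u]; last by rewrite !ffunE.
  rewrite (bigD1 t) //= ffunE mbt mul1r; congr (_ + _).
  by apply: eq_bigr => u _; rewrite ffunE.
have rest k : ~ ((hA k < hA t)%N /\ (hA k + hB (d k) = hA t + hB (d t))%N) ->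
    \sum_(u | u != t) mb u * bA (ind u) k = 0.
  move=> nk; apply: big1 => u ut; have [/mb0->|mu] := eqVneq (m u t) 0; first by rewrite mul0r.
  have [lt e] := m_tri ut mu.
  have [_ IHu] := IH u (leq_trans lt tN).
  have [ku|ku] := eqVneq k u; first by case: nk; rewrite ku.
  have [->|bk] := eqVneq (bA (ind u) k) 0; first by rewrite mulr0.
  by have [lt' e'] := IHu k ku bk; case: nk; split; [exact: ltn_trans lt | rewrite e'].
split=> [|u ut bu].
  by have := expand t; rewrite m1 rest ?addr0 // => -[]; rewrite ltnn.
have [mu|mu] := eqVneq (m u t) 0; last exact: m_tri.
have [lt|ge] := ltnP (hA u) (hA t); last first.
  have := expand u; rewrite mu rest ?addr0 => [e|[]]; last by rewrite ltnNge ge.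
  by rewrite -e eqxx in bu.
have [e|ne] := eqVneq (hA u + hB (d u))%N (hA t + hB (d t))%N; first by [].
have := expand u; rewrite mu rest ?addr0 => [e|[_ /eqP e]].
  by rewrite -e eqxx in bu.
by rewrite e in ne.
Qed.

Lemma bA_VA s f : TA s (bA f) = bA (VA s f).
Proof. by rewrite -{1}(heckeK hA (nA s) (sAK s) f) bAT. Qed.

Lemma bB_TB s f : bB (TB s f) = VB s (bB f).
Proof. by rewrite -(bBT s f) /VB heckeVK. Qed.

Lemma VA_cbar s (f g : {ffun A -> LF}) : (forall u, cbar (f u) (g u)) ->
  exists gb : A -> LF, forall u, cbar (VA s f u) (gb u).
Proof.
move=> fg; apply: (@fin_all_exists A (fun=> LF) (fun u => cbar (VA s f u))) => u; rewrite !ffunE.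
have cq : cbar (X - X^-1) (X^-1 - X) by apply: cbarD; [exact: cbarX|exact/cbarN/cbarXV].
have ca : exists b, cbar (hecke hA (sA s) (nA s) f u) b.
  rewrite ffunE; case: ifP => _; first by eexists; apply: fg.
  case: ifP => _; first by eexists; apply: cbarD (fg _) (cbarM cq (fg _)).
  case: (nA s u); eexists; apply: cbarM (fg _); last exact: cbarX.
  exact/cbarN/cbarXV.
case: ca => b; rewrite ffunE => cb.
by eexists; apply: cbarD cb (cbarN (cbarM cq (fg _))).
Qed.

(** If [s] lowers [d l], then [ind (d l)] is [TB s] of a lower basis vector, and adjunction moves
    the operator to the other side. There it replaces [f] by [VA s f], which is why [f] is
    arbitrary. *)
Lemma pr_bar l (f g : {ffun A -> LF}) : (forall u, cbar (f u) (g u)) ->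
  pr (bA f) (bB (ind (d l))) = (-1) ^+ hA l * g l.
Proof.
have [N] := ubnP (hB (d l)); elim: N l f g => // N IH l f g; rewrite ltnS => lN fg.
have [s lts|loc] := pickP (fun s => hB (sB s (d l)) < hB (d l))%N; last first.
  have {}loc s : ~~ (hB (sB s (d l)) < hB (d l))%N by rewrite loc.
  rewrite bB_min // /pr (bigD1 l) //= big1 ?addr0 => [|a al]; last first.
    by rewrite !ffunE (bij_eq d_bij) (negbTE al) !mulr0.
  rewrite ffunE eqxx mulr1 (bar_expand bAD bAZ fg) (bigD1 l) //=.
  rewrite (bar_ind_tri l).1 mulr1 big1 ?addr0 // => u ul.
  (* A nonzero coefficient would put [l] strictly below [u] with the same height sum, impossible
     when [hB (d l) = 0]. *)
  have [->|bu] := eqVneq (bA (ind u) l) 0; first by rewrite mulr0.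
  rewrite eq_sym in ul; have [] := (bar_ind_tri u).2 l ul bu.
  by have := h_min loc; lia.
have hs := h_sum s l; have lt' : (hA l < hA (sA s l))%N by move: lts; rewrite -dS; lia.
rewrite (hecke_ind (nB s) (sBK s) lts) -/(TB s _) bB_TB.
rewrite -[LHS]opprK -pr_adjoint bA_VA -dS.
have [gb gbP] := VA_cbar s fg.
rewrite (IH _ _ [ffun u => gb u]); last 2 first.
- by rewrite dS; apply: leq_trans lts lN.
- by move=> u; rewrite ffunE.
rewrite (h_step lt') exprS mulN1r mulNr opprK ffunE; congr (_ * _).
(* At the upper point [sA s l], the value of [VA s f] is just [f l]. *)
apply: cbar_fun (gbP _) _; rewrite !ffunE sAK ltnNge ltnW //= lt' addrK.
exact: fg.
Qed.

Lemma pr_canonical t k :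
  \sum_a (-1) ^+ hA a * (m a t * n (d a) (d k)) = ((-1) ^+ hA t * (t == k)%:R) :> LF.
Proof.
set E := \sum_a _.
have [e|tk] := eqVneq t k.
  rewrite /E -e (bigD1 t) //= m1 n1 !mulr1 big1 ?addr0 // => a at_.
  have [->|ma] := eqVneq (m a t) 0; first by rewrite mul0r mulr0.
  have [->|na] := eqVneq (n (d a) (d t)) 0; first by rewrite !mulr0.
  (* [m] asks for [a] below [t], hence [d a] above [d t] by the constant height sum, while [n] asks
     for the reverse. *)
  have := m_tri at_ ma; have := n_tri _ na; rewrite (bij_eq d_bij) => /(_ at_); lia.
rewrite mulr0; apply: laurent_neg_selfbar.
  apply: laurent_neg_sum => a; apply: laurent_neg_sign.
  have [->|at_] := eqVneq a t; first by rewrite m1 mul1r; apply: n_neg; rewrite (bij_eq d_bij).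
  have [->|ak] := eqVneq a k; first by rewrite n1 mulr1; apply: m_neg; rewrite eq_sym.
  by apply: laurent_negM; [apply: m_neg | apply: n_neg; rewrite (bij_eq d_bij)].
have [mb mbP] := m_cbar t; have [nb nbP] := n_cbar (d k).
have EE : E = pr (bA [ffun u => m u t]) (bB [ffun u => n u (d k)]).
  by rewrite m_bar n_bar; apply: eq_bigr => a _; rewrite !ffunE.
(* The right side is the termwise conjugate of [E]. That it equals [E] comes from expanding the
   second bar invariant vector and applying [pr_bar]. *)
suff {2}-> : E = \sum_a (-1) ^+ hA a * (mb a * nb (d a)).
  by apply: cbar_sum => a; apply: cbar_sign; apply: cbarM.
have nE b : bB [ffun u => n u (d k)] b = \sum_u nb u * bB (ind u) b.
  rewrite (@bar_expand _ _ bBD bBZ _ [ffun u => nb u]) => [|u]; last by rewrite !ffunE.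
  by apply: eq_bigr => u _; rewrite ffunE.
rewrite EE /pr; under eq_bigr => a _ do rewrite nE mulr_sumr mulr_sumr.
rewrite exchange_big /= (reindex d) /=; last by case: d_bij => e h1 h2; exists e => x _.
apply: eq_bigr => l _.
transitivity (nb (d l) * pr (bA [ffun u => m u t]) (bB (ind (d l)))).
  by rewrite /pr mulr_sumr; apply: eq_bigr => a _; rewrite [RHS]mulrCA; congr (_ * _); rewrite mulrCA.
rewrite (@pr_bar _ _ [ffun u => mb u]) => [|u]; last by rewrite !ffunE.
by rewrite ffunE mulrCA [nb _ * _]mulrC.
Qed.

(** [pr_canonical] sums over the row indices of [m] and [n], this identity over the column indices.
    They say [P1 P2 = 1] and [P2 P1 = 1], equivalent for square matrices. *)
Theorem canonical_inversion u t :
  \sum_k (-1) ^+ (hA u + hA k) * m u k * n (d t) (d k) = (u == t)%:R :> LF.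
Proof.
pose v (i : 'I_#|A|) : A := enum_val i.
pose P1 := \matrix_(i, j) ((-1) ^+ (hA (v i) + hA (v j)) * m (v j) (v i)) : 'M[LF]_#|A|.
pose P2 := \matrix_(i, j) n (d (v i)) (d (v j)) : 'M[LF]_#|A|.
have sumE (F : A -> LF) : \sum_a F a = \sum_(i < #|A|) F (v i).
  by rewrite (reindex v) //; apply: onW_bij; apply: enum_val_bij.
have P12 : P1 *m P2 = 1%:M.
  apply/matrixP => i j; rewrite !mxE.
  have := pr_canonical (v i) (v j); rewrite sumE => /(congr1 ( *%R ((-1) ^+ hA (v i)))).
  rewrite mulrA -expr2 sqrr_sign mul1r (inj_eq enum_val_inj) => <-.
  by rewrite mulr_sumr; apply: eq_bigr => l _; rewrite !mxE exprD !mulrA.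
have /matrixP/(_ (enum_rank t) (enum_rank u)) := mulmx1C P12.
rewrite !mxE (inj_eq enum_rank_inj) eq_sym => <-; rewrite sumE; apply: eq_bigr => l _.
by rewrite !mxE /v !enum_rankK mulrC addnC.
Qed.

End Pairing.

(** * The modules of the theorem *)

Section Module.
Variables (W : finGroupType) (S K : {set W}).
Hypotheses (coxS : coxeter_system S) (KS : K \subset S).
Let I : finType := {s : W | s \in S}.

Definition ht_pair (a : KT S K) : nat := ht S K (val a).

Definition act_pair (s : I) (a : KT S K) : KT S K :=
  Sub (sact S K (val s) (val a)) (sact_KK coxS KS (valP s) (valP a)).

Definition neg_pair (rho : W -> int) (s : I) (a : KT S K) : bool :=
  rho ((val a).1^-1 * val s * (val a).1)%g == (-1)%R.

Lemma act_pairK s : involutive (act_pair s).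
Proof. by move=> a; apply: val_inj; rewrite /= sactK // ?(valP s) ?(valP a). Qed.

Lemma Ts_hecke rho (s : I) (f : {ffun KT S K -> LF}) :
  Ts rho (val s) f = hecke ht_pair (act_pair s) (neg_pair rho s) f.
Proof.
apply/ffunP => u; rewrite ffunE [RHS]ffunE.
rewrite -(hecke_sum ht_pair (neg_pair rho s) X X^-1%R f u (@act_pairK s)).
by apply: eq_bigr => t _; rewrite ffunE.
Qed.

Lemma bar_spec_hecke rho bar : bar_spec rho bar ->
  [/\ forall f g : {ffun KT S K -> LF}, bar (f + g)%R = (bar f + bar g)%R,
      forall a b (f : {ffun KT S K -> LF}), cbar a b ->
        bar [ffun u => a * f u]%R = [ffun u => b * bar f u]%R,
      forall (s : I) f, hecke ht_pair (act_pair s) (neg_pair rho s)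
        (bar (hecke ht_pair (act_pair s) (neg_pair rho s) f)) = bar f &
      forall a, (forall s, ~~ (ht_pair (act_pair s a) < ht_pair a)%N) -> bar (ind a) = ind a].
Proof.
case=> barD barZ barT bar_min; split=> // [a b f [n [p [-> ->]]]|s f|a amin].
- exact: barZ.
- by rewrite -!Ts_hecke barT // (valP s).
- by apply: bar_min => s sS; apply: (amin (Sub s sS)).
Qed.

Lemma ht_pair_min a : (forall s, ~~ (ht_pair (act_pair s a) < ht_pair a)%N) -> ht_pair a = 0%N.
Proof.
move=> amin; apply: ht_local_min => //; first exact: valP.
by move=> s sS; apply: (amin (Sub s sS)).
Qed.

Lemma ht_pair_step s a : (ht_pair a < ht_pair (act_pair s a))%N ->
  ht_pair (act_pair s a) = (ht_pair a).+1.
Proof.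
rewrite /ht_pair /=; case: (ht_sact_cases coxS KS (valP s) (valP a)) => [//|->|[->]].
  by rewrite ltnNge leqnSn.
by rewrite ltnn.
Qed.

Lemma canon_spec_prec rho m : canon_spec S K rho m ->
  exists bar, [/\ @bar_spec _ S K rho bar,
    forall t : KT S K, bar [ffun u : KT S K => m (val u) (val t)] = [ffun u => m (val u) (val t)],
    forall t : KT S K, m (val t) (val t) = 1%R,
    forall u t : KT S K, u != t -> laurent_neg (m (val u) (val t)) &
    forall u t : KT S K, u != t -> m (val u) (val t) != 0%R -> prec S K (val u) (val t)].
Proof.
case=> bar [barP mP]; exists bar; split=> // [t|t|u t ut|u t ut].
- by case: (mP t).
- by case: (mP t) => _ [].
- case: (mP t) => _ [_ /(_ u ut)]; case: ifP => // _ ->; exact: laurent_neg0.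
- by case: (mP t) => _ [_ /(_ u ut)]; case: ifP => // _ ->; rewrite eqxx.
Qed.

End Module.

(** * The hypotheses of the abstract pairing, verified for dual pairs *)

Section DualPairs.
Variables (W : finGroupType) (S J : {set W}).
Hypotheses (coxS : coxeter_system S) (JS : J \subset S).
Let J' := dualJ S J.
Let JS' : J' \subset S := dualJ_sub coxS JS.

Definition dual_pair (a : KT S J) : KT S J' := Sub (dualk S J (val a)) (dualk_KK coxS JS (valP a)).

(** Surjectivity follows by counting: dualising again is injective and leads back to [J], as [dualJ]
    is an involution. *)
Lemma dual_pair_bij : bijective dual_pair.
Proof.
apply: inj_card_bij => [a b /(congr1 val) /= e|].
  by apply: val_inj; apply: (dualk_inj coxS JS (valP a) (valP b) e).
rewrite !card_sig -(card_in_imset (dualk_inj coxS JS')).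
apply: subset_leq_card; apply/subsetP => _ /imsetP[k kK ->].
by have := dualk_KK coxS JS' kK; rewrite dualJJ.
Qed.

Lemma dual_pair_act s a :
  dual_pair (act_pair coxS JS s a) = act_pair coxS JS' s (dual_pair a).
Proof. by apply: val_inj; apply: (dualk_sact coxS JS (valP s) (valP a)). Qed.

Lemma ht_pair_sum s a :
  (ht_pair (act_pair coxS JS s a) + ht_pair (dual_pair (act_pair coxS JS s a)) =
   ht_pair a + ht_pair (dual_pair a))%N.
Proof. exact: (ht_dualk_sact coxS JS (valP s) (valP a)). Qed.

Lemma ht_orbit_sum (a b : KT S J) : same_orbit S J (val a) (val b) ->
  (ht_pair a + ht_pair (dual_pair a) = ht_pair b + ht_pair (dual_pair b))%N.
Proof.
case/connectP => q; elim: q a => [|x q IH] a /=; first by move=> _ /val_inj ->.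
case/andP => /existsP[s /andP[sS /eqP xE]] pq bE.
rewrite -(ht_pair_sum (Sub s sS) a); apply: IH; rewrite /= -xE //.
Qed.

(** Equal heights force [t = w^-1 s w] into [J]. Its dual is again a simple reflection, so the sign
    character contributes [-1], while [sigma] does not see the conjugation by [w_J]. *)
Lemma neg_pair_dual sigma s a : sign_hom J sigma ->
  ht_pair (act_pair coxS JS s a) = ht_pair a ->
  neg_pair (sgn_times S (dual_sigma S sigma)) s (dual_pair a) = ~~ neg_pair sigma s a.
Proof.
case=> sM s1 hs; have aK := valP a; have sS := valP s.
have tJ : ((val a).1^-1 * val s * (val a).1)%g \in J.
  move: hs; rewrite /ht_pair /=; case: (ht_sact_cases coxS JS sS aK) => [->|->|[_ wn] _].
  - by move/esym/n_Sn.
  - by move/n_Sn.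
  - move: (aK); rewrite inE => /andP[amin _].
    by have [|[_ //]] := deodhar coxS JS sS amin; rewrite (negbTE wn).
rewrite /neg_pair /= dualk_conj //; set t := (_^-1 * _ * _)%g in tJ *; clearbody t.
set p := longest S <<J>>%g; have tgJ := mem_gen tJ.
have pJ : p \in <<J>>%g by apply: mem_longest.
rewrite /sgn_times len_w0J // len_longestJ // len_simple ?(subsetP JS) // expr1 mulN1r.
have -> : dual_sigma S sigma (w0 S * (p * t * p) * w0 S)%g = sigma t.
  rewrite /dual_sigma w0_inv // -!mulgA !w0M // w0_sqr // mulg1 mulgA.
  rewrite !sM ?groupM //; have [->|->] := s1 p pJ.
    by rewrite mul1r mulr1.
  by rewrite mulN1r mulrN1 opprK.
by have [->|->] := s1 t tgJ.
Qed.

End DualPairs.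

Theorem mainTheorem18 (W : finGroupType) (S J : {set W}) (sigma : W -> int)
  (m n : P W -> P W -> LF) :
  coxeter_system S -> J \subset S -> sign_hom J sigma ->
  canon_spec S J sigma m ->
  canon_spec S (dualJ S J) (sgn_times S (dual_sigma S sigma)) n ->
  forall u t, u \in KK S J -> t \in KK S J ->
    (\sum_(k in KK S J)
       (-1) ^+ (ht S J u + ht S J k) * m u k * n (dualk S J t) (dualk S J k))%R
    = (((u == t)%:R)%R : LF).
Proof.
move=> coxS JS hsigma cm cn u t uK tK; pose JS' := dualJ_sub coxS JS.
have [bA [/(bar_spec_hecke coxS JS) [bAD bAZ bAT _] m_bar m1 m_neg m_prec]] := canon_spec_prec cm.
have [bB [/(bar_spec_hecke coxS JS') [bBD bBZ bBT bB_min] n_bar n1 n_neg n_prec]] :=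
  canon_spec_prec cn.
pose u' : KT S J := Sub u uK; pose t' : KT S J := Sub t tK.
have := @canonical_inversion _ _ _ (dual_pair coxS JS) (@ht_pair _ _ _) (act_pair coxS JS)
  (neg_pair sigma) (@ht_pair _ _ _) (act_pair coxS JS')
  (neg_pair (sgn_times S (dual_sigma S sigma))) bA bB
  (fun a b => m (val a) (val b)) (fun a b => n (val a) (val b))
  (act_pairK coxS JS) (act_pairK coxS JS') (dual_pair_bij coxS JS) (dual_pair_act coxS JS)
  (ht_pair_sum coxS JS) (@ht_pair_step _ _ _ coxS JS)
  (fun s a => @neg_pair_dual _ _ _ coxS JS sigma s a hsigma) (@ht_pair_min _ _ _ coxS JS')
  bAD bAZ bAT bBD bBZ bBT bB_min m_bar m1 m_neg _ n_bar n1 n_neg _ u' t'.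
rewrite -[u' == t']/(u == t) => <-.
(* [u'] merely serves as the default of [insubd] outside [KK S J]. *)
- rewrite (reindex_onto val (insubd u')) /=; last by move=> k kK; rewrite insubdK.
  apply: eq_bigl => k; rewrite (valP k) valKd eqxx //.
- move=> a b ab mab; have /and3P[orb lt _] := m_prec a b ab mab.
  by split=> //; apply: ht_orbit_sum.
- by move=> a b ab nab; have /and3P[] := n_prec a b ab nab.
Qed.
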